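(* Let $G$ be a finite group, $N\lhd G$ a normal subgroup and $F$ a field whose characteristic does not divide $|A(G)\cap N|$. Let $k\ge 1$. Then the following are equivalent. (1) $S(G)\cap N$ is $k$-generated as a normal subgroup of $G$. (2) $A(G)\cap N$ is $k$-generated as a $\mathbb ZG$-module. (3) $A(G)_p\cap N$ is $k$-generated as an $\mathbb F_pG$-module for each prime divisor $p$ of $|A(G)|$. (4) $G$ has a completely reducible representation over $F$ with $k$ irreducible constituents that restricts to a faithful representation of $N$.
   Context: A minimal normal subgroup of $G$ is a minimal nontrivial normal subgroup. $A(G)$ is the subgroup generated by all abelian minimal normal subgroups of $G$, and the socle $S(G)$ is the subgroup generated by all minimal normal subgroups of $G$. $A(G)$ is an abelian normal subgroup, and $A(G)\cap N$ is a $\mathbb ZG$-module via conjugation. For a prime $p$, $A(G)_p$ is the $p$-Sylow subgroup of $A(G)$; it is an elementary abelian $p$-group, so $A(G)_p\cap N$ is an $\mathbb F_pG$-module. A module (respectively normal subgroup) is $k$-generated (respectively $k$-generated as a normal subgroup) if it can be generated by $k$ not necessarily distinct elements (respectively is the normal closure in $G$ of $k$ not necessarily distinct elements). A completely reducible representation is one afforded by a (finite-dimensional) semisimple module; its irreducible constituents are the simple summands, counted with multiplicity. The characteristic $0$ divides no positive integer. *)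

(* Defs.v *)
From HB Require Import structures.
From mathcomp Require Import all_boot all_order all_algebra.
From mathcomp Require Import all_fingroup all_solvable all_character.

Set Implicit Arguments.
Unset Strict Implicit.
Unset Printing Implicit Defensive.

Import GRing.Theory FiniteModule.

Local Open Scope group_scope.

Section Socles.

Variables (gT : finGroupType) (G : {set gT}).

Definition min_normal (M : {group gT}) : bool :=
  [min M of H | H :!=: 1 & H <| G].

Definition socle_of : {set gT} :=
  <<\bigcup_(M : {group gT} | min_normal M) M>>.
Canonical socle_of_group := Eval hnf in [group of socle_of].

Definition abelian_socle : {set gT} :=
  <<\bigcup_(M : {group gT} | min_normal M && abelian M) M>>.
Canonical abelian_socle_group := Eval hnf in [group of abelian_socle].

End Socles.

Section AbelianSocle.

Variables (gT : finGroupType) (G : {group gT}).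

Lemma min_normal_minnormal (M : {group gT}) : min_normal G M -> minnormal M G.
Proof.
case/mingroupP=> /andP[ntM nsMG] minM; apply/mingroupP.
split=> [|H /andP[ntH nHG] sHM]; first by rewrite ntM normal_norm.
by apply: minM => //; rewrite ntH /normal (subset_trans sHM (normal_sub nsMG)).
Qed.

Lemma min_normal_cent (M1 M2 : {group gT}) :
  min_normal G M1 -> min_normal G M2 -> abelian M1 -> M1 \subset 'C(M2).
Proof.
move=> min1 min2 ab1.
case/mingroupP: min1 => /andP[_ ns1] min1.
case/mingroupP: min2 => /andP[_ ns2] min2.
have [ti|nt] := eqVneq (M1 :&: M2) 1.
  apply/commG1P/trivgP; rewrite -ti subsetI commg_subl commg_subr.
  rewrite (subset_trans (normal_sub ns1) (normal_norm ns2)).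
  by rewrite (subset_trans (normal_sub ns2) (normal_norm ns1)).
have P12 : (M1 :&: M2 :!=: 1) && (M1 :&: M2 <| G) by rewrite nt normalI.
have e1 := min1 [group of M1 :&: M2] P12 (subsetIl _ _).
have e2 := min2 [group of M1 :&: M2] P12 (subsetIr _ _).
by rewrite -e2 /= e1.
Qed.

Lemma abelian_socle_abelian : abelian (abelian_socle G).
Proof.
rewrite abelian_gen /abelian.
apply/bigcupsP=> M1 /andP[min1 ab1]; rewrite centsC.
apply/bigcupsP=> M2 /andP[min2 ab2].
exact: min_normal_cent.
Qed.

Lemma abelian_socle_Sylow p :
  p.-Sylow(abelian_socle G) 'O_p(abelian_socle G).
Proof. exact: nilpotent_pcore_Hall (abelian_nil abelian_socle_abelian). Qed.

Lemma pcore_abelian_socle_abelem p :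
  prime p -> p.-abelem 'O_p(abelian_socle G).
Proof.
move=> pr_p; have abA := abelian_socle_abelian.
set A := abelian_socle G in abA *; pose n := (p * #|A|`_p^')%N.
rewrite abelemE // (abelianS (pcore_sub p A)) //=.
rewrite (exponent_Hall (abelian_socle_Sylow p)).
have expA : exponent A %| n.
  have abU : abelian (\bigcup_(M | min_normal G M && abelian M) M).
    by rewrite -abelian_gen.
  rewrite /A /abelian_socle abelian_exponent_gen //.
  apply/exponentP=> x /bigcupP[M /andP[minM abM] Mx].
  have [|_ _] := minnormal_solvable (min_normal_minnormal minM) (subxx M).
    exact: abelian_sol.
  case/is_abelemP=> q pr_q abelM.
  have [->|ntx] := eqVneq x 1; first by rewrite expg1n.
  have ox : #[x] = q := abelem_order_p abelM Mx ntx.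
  have Ax : x \in A.
    by apply/mem_gen/bigcupP; exists M; rewrite ?minM.
  have qn : q %| n.
    have [->|neq_qp] := eqVneq q p; first exact: dvdn_mulr.
    apply: dvdn_mull; have q_p' : p^'.-nat q by rewrite pnatE // !inE.
    by rewrite -(part_pnat_id q_p') partn_dvd // -ox order_dvdG.
  by apply/eqP; rewrite -order_dvdn ox.
have n_gt0 : 0 < n by rewrite muln_gt0 prime_gt0 ?part_gt0.
have np : (n`_p)%N = p.
  rewrite /n partnM ?part_gt0 ?(prime_gt0 pr_p) // (part_pnat_id (pnat_id pr_p)).
  by rewrite (part_p'nat (part_pnat _ _)) muln1.
rewrite -[X in _ %| X]np.
exact: partn_dvd.
Qed.

Variable N : {group gT}.

Lemma abelian_socleI_abelian : abelian (abelian_socle G :&: N).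
Proof. exact: abelianS (subsetIl _ _) abelian_socle_abelian. Qed.

Lemma pcore_abelian_socleI_abelem p :
  prime p -> p.-abelem ('O_p(abelian_socle G) :&: N).
Proof.
by move=> pr_p; apply: abelemS (subsetIl _ _) (pcore_abelian_socle_abelem pr_p).
Qed.

End AbelianSocle.

(* The 'F_p-module of the elements of an elementary abelian p-group E; unlike *)
(* 'rV(E) in mxabelem, it does not require E to be nontrivial.                *)
Section FpModule.

Variables (gT : finGroupType) (p : nat) (E : {group gT}).

Definition fpmod_of (pr_p : prime p) (abelE : p.-abelem E) : Type :=
  fmod_of (abelem_abelian abelE).

Variables (pr_p : prime p) (abelE : p.-abelem E).
Local Notation V := (fpmod_of pr_p abelE).
Local Open Scope ring_scope.

HB.instance Definition _ := GRing.Zmodule.on V.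

Definition fpmod_scale (a : 'F_p) (v : V) : V := v *+ (a : nat).

Lemma fpmod_mulrn_mod (v : V) n : v *+ (n %% (Zp_trunc (pdiv p)).+2) = v *+ n.
Proof.
rewrite Fp_cast // [in RHS](divn_eq n p) mulrnDr mulnC mulrnA.
suff -> : v *+ p = 0 by rewrite mul0rn add0r.
apply: (@fmod_inj _ _ (abelem_abelian abelE)).
rewrite (fmvalZ p (v : fmod_of (abelem_abelian abelE))).
by have /(abelemP pr_p)[_ ->] := abelE; last exact: fmodP.
Qed.

Fact fpmod_scaleA a b v :
  fpmod_scale a (fpmod_scale b v) = fpmod_scale (a * b) v.
Proof. by rewrite /fpmod_scale fpmod_mulrn_mod mulnC mulrnA. Qed.

Fact fpmod_scale1 : left_id 1 fpmod_scale.
Proof. by move=> v; rewrite /fpmod_scale /= mulr1n. Qed.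

Fact fpmod_scaleDr : right_distributive fpmod_scale +%R.
Proof. by move=> a u v; rewrite /fpmod_scale mulrnDl. Qed.

Fact fpmod_scaleDl v : {morph fpmod_scale^~ v : a b / a + b}.
Proof. by move=> a b; rewrite /fpmod_scale fpmod_mulrn_mod mulrnDr. Qed.

HB.instance Definition _ := GRing.Zmodule_isLmodule.Build 'F_p V
  fpmod_scaleA fpmod_scale1 fpmod_scaleDr fpmod_scaleDl.

End FpModule.

(* An R[G]-module is given by its R-module V and the (right) action of G on V. *)
Section GroupRingModule.

Variables (gT : finGroupType) (G : {set gT}) (R : pzRingType) (V : lmodType R).
Variable act : V -> gT -> V.
Local Open Scope ring_scope.

(* The action on v of the element \sum_(g in G) r g *: g of R[G]. *)
Definition gring_act (r : gT -> R) (v : V) : V :=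
  \sum_(g in G) r g *: act v g.

Definition module_k_generated (k : nat) : Prop :=
  exists x : 'I_k -> V,
    forall v, exists r : 'I_k -> gT -> R, v = \sum_(i < k) gring_act (r i) (x i).

End GroupRingModule.

Definition normal_k_generated (gT : finGroupType) (G H : {set gT}) (k : nat) :=
  exists x : 'I_k -> gT, H = <<class_support [set x i | i : 'I_k] G>>.

Section ConjugationModules.

Variables (gT : finGroupType) (G E : {group gT}) (k : nat).

Definition ZG_k_generated (abE : abelian E) : Prop :=
  @module_k_generated gT G int (zmodule (fmod_of abE)) (@actr gT E abE) k.

Definition FpG_k_generated (p : nat) (pr_p : prime p) (abelE : p.-abelem E) :=
  @module_k_generated gT G 'F_p (fpmod_of pr_p abelE)
    (@actr gT E (abelem_abelian abelE)) k.

End ConjugationModules.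

(* mxsemisimple rG 1%:M, with exactly k simple summands. *)
Definition semisimple_constituents (F : fieldType) (gT : finGroupType)
    (G : {group gT}) (n : nat) (rG : mx_representation F G n) (k : nat) :=
  exists U : 'I_k -> 'M[F]_n,
    [/\ forall i, mxsimple rG (U i), (\sum_(i < k) U i :=: 1%:M%R)%MS
      & mxdirect (\sum_(i < k) U i)%MS].

(* Main.v *)
(** A completely reducible representation with k constituents is faithful on N
    iff no minimal normal subgroup of G inside N lies in all k kernels.  On a
    Sylow subgroup E of A(G) :&: N, an irreducible constituent of the
    restriction of the i-th summand has a kernel C_i with E / C_i cyclic, and
    the common core of the C_i in G is then trivial.  So (4) says that the dual
    of the G-module E is generated by k functionals, and the point is that a
    finite semisimple module is k-generated iff its dual is.  This is proved by
    splitting off a simple summand S, M = S + M': given generators x' of M',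
    some s in S^k makes (s, x') generate M unless every s is the image of x'
    under a homomorphism M' -> S, and there are too few of these, because
    |Hom(M', S)| = |Hom(S, M')| while the k functionals embed Hom(S, M) into the
    k-fold power of the dual of S.

    Conversely, given such kernels C_p for all primes p, the summand of (4) is
    an irreducible quotient of the regular representation in which a vector is
    fixed by all C_p and killed by the norm of some z_p in E_p outside C_p, and
    also by the norm of some nontrivial g_M of order prime to char F in each
    nonabelian minimal normal subgroup M.  As a function on G such a vector is
    an explicit product of differences of indicators. *)

Require Import Defs.
From mathcomp Require Import all_boot all_order all_algebra.
From mathcomp Require Import all_fingroup all_solvable all_character.
From Stdlib Require Import Classical_Prop.

Set Implicit Arguments.
Unset Strict Implicit.
Unset Printing Implicit Defensive.

Import GRing.Theory FiniteModule.

Local Open Scope group_scope.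

(** * Semisimple representations over finite fields *)

Section Separation.

Local Open Scope ring_scope.

Variables (F : fieldType) (gT : finGroupType) (G : {group gT}).
Local Notation reprG := (mx_representation F G).

(** The translates of the rows of [X] span the module, expressed by the absence of a nonzero
    functional [w] vanishing on them. Transposition then exchanges this with [cogenerates], where
    the columns of [Y] are the functionals. *)
Definition generates k n (rG : reprG n) (X : 'M[F]_(k, n)) :=
  forall w : 'cV_n, {in G, forall g, X *m rG g *m w = 0} -> w = 0.

Definition cogenerates k n (rG : reprG n) (Y : 'M[F]_(n, k)) :=
  forall v : 'rV_n, {in G, forall g, v *m rG g *m Y = 0} -> v = 0.

(* Irreducibility in a form that is visibly invariant under duality. *)
Definition separating n (rG : reprG n) :=
  (0 < n)%N /\ forall (v : 'rV_n) (w : 'cV_n),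
    {in G, forall g, v *m rG g *m w = 0} -> v = 0 \/ w = 0.

(** The cyclic module of a nonzero [v] is everything, so a column killed by all translates of [v] is
    zero. *)
Lemma irr_separating n (rG : reprG n) : mx_irreducible rG -> separating rG.
Proof.
move=> irrG; split=> [|v w vw0].
  by case: irrG => _; rewrite -mxrank_eq0 mxrank1 lt0n.
have [->|nzv] := eqVneq v 0; [by left | right].
have [_ _ /(_ _ (cyclic_mx_module rG v) (submx1 _))] := irrG.
rewrite cyclic_mx_eq0 => /(_ nzv) full.
apply/eqP; rewrite -[w]mul1mx; apply/eqP/row_matrixP => i.
rewrite row_mul row0.
have /cyclic_mxP[A /envelop_mxP[a ->] ->] : (row i 1%:M <= cyclic_mx rG v)%MS.
  exact: submx_trans (row_sub _ _) full.
rewrite mulmx_sumr mulmx_suml big1 // => g Gg.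
by rewrite -scalemxAr -scalemxAl vw0 ?scaler0.
Qed.

Section Dual.

Variables (n : nat) (rG : reprG n).

Definition dual_mx (g : gT) : 'M[F]_n := (rG g^-1%g)^T.

Lemma dual_mx_repr : mx_repr G dual_mx.
Proof.
split=> [|x y Gx Gy]; rewrite /dual_mx ?invg1 ?repr_mx1 ?trmx1 //.
by rewrite invMg repr_mxM ?groupV // trmx_mul.
Qed.

Definition dual_repr := MxRepresentation dual_mx_repr.

Lemma trmx_dual m p g (v : 'M[F]_(m, n)) (w : 'M[F]_(n, p)) :
  v *m dual_repr g *m w = (w^T *m rG g^-1%g *m v^T)^T.
Proof. by rewrite !trmx_mul !trmxK mulmxA. Qed.

Lemma dual_separating : separating rG -> separating dual_repr.
Proof.
case=> n_gt0 sepG; split=> // v w vw0.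
have [g Gg | /eqP | /eqP] := sepG w^T v^T; last 2 first.
- by rewrite trmx_eq0 => /eqP->; right.
- by rewrite trmx_eq0 => /eqP->; left.
apply: trmx_inj; rewrite trmx0 -[in LHS](invgK g) -trmx_dual.
exact: vw0 (groupVr Gg).
Qed.

Lemma generates_dual k (X : 'M_(k, n)) :
  generates rG X -> cogenerates dual_repr X^T.
Proof.
move=> genX v v0; apply/trmx_inj; rewrite trmx0; apply: genX => g Gg.
apply: trmx_inj; rewrite trmx0 -[in LHS](invgK g) -[X]trmxK -trmx_dual.
exact: v0 (groupVr Gg).
Qed.

Lemma generates_of_dual k (X : 'M_(k, n)) :
  generates dual_repr X -> cogenerates rG X^T.
Proof.
move=> genX v v0; apply/trmx_inj; rewrite trmx0; apply: genX => g Gg.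
by rewrite trmx_dual trmxK v0 ?trmx0 ?groupV.
Qed.

End Dual.

(** Summands are split off one at a time, for induction; asking [separating] of them makes the class
    closed under duality. *)
Inductive semisimple_repr : representation F G -> Prop :=
| SemisimpleRepr0 (r : representation F G) of rdegree r = 0%N :
  semisimple_repr r
| SemisimpleReprD (r r1 r2 : representation F G) of separating r1
    & semisimple_repr r2
    & mx_rsim r (dadd_grepr r1 r2) : semisimple_repr r.

Lemma dual_rsim n1 n2 (r1 : reprG n1) (r2 : reprG n2) :
  mx_rsim r1 r2 -> mx_rsim (dual_repr r2) (dual_repr r1).
Proof.
case=> B eqn injB homB; exists B^T => // [|x Gx].
  move: r1 r2 B injB homB; rewrite eqn => _ _ B injB _.
  by move: injB; rewrite !row_free_unit unitmx_tr.
by rewrite -!trmx_mul homB ?groupV.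
Qed.

Lemma semisimple_dual (r : representation F G) :
  semisimple_repr r -> semisimple_repr (Representation (dual_repr r)).
Proof.
elim=> {r} [r r0 | r r1 r2 sep1 _ ss2 simr]; first exact: SemisimpleRepr0.
apply: (@SemisimpleReprD _ (Representation (dual_repr r1)) _ _ ss2) => /=.
  exact: dual_separating.
apply: mx_rsim_trans (mx_rsim_sym (dual_rsim simr)) _.
exists 1%:M => // [|x Gx]; first by rewrite row_free_unit unitmx1.
by rewrite mulmx1 mul1mx /= /dual_mx /= tr_block_mx !trmx0.
Qed.

Lemma semisimple_rsim (r s : representation F G) :
  mx_rsim s r -> semisimple_repr r -> semisimple_repr s.
Proof.
move=> simsr ssr; case: ssr simsr => {r} [r r0 | r r1 r2 sep1 ss2 simr] simsr.
  by apply: SemisimpleRepr0; rewrite -r0; apply: mxrank_rsim simsr.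
exact: SemisimpleReprD sep1 ss2 (mx_rsim_trans simsr simr).
Qed.

Lemma mxsemisimple_repr n (rG : reprG n) :
  mxsemisimple rG 1%:M -> semisimple_repr (Representation rG).
Proof.
case=> I U S simU defS dxS.
have modU i : mxmodule rG (U i) by case: (simU i).
pose rU i := Representation (submod_repr (modU i)).
refine (@semisimple_rsim (\big[@dadd_grepr F gT G/@grepr0 F gT G]_i rU i)
  (Representation rG) _ _) => /=.
  apply: mx_rsim_trans (mx_rsim_sym (rsim_submod1 (mxmodule1 rG) _)) _ => //.
  by apply: mx_rsim_dsum defS dxS _ => i; apply: mx_rsim_refl.
elim: (index_enum I) => [|i s IHs].
  by rewrite big_nil; apply: SemisimpleRepr0.
rewrite big_cons; apply: SemisimpleReprD _ IHs (mx_rsim_refl _).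
exact/irr_separating/submod_mx_irr.
Qed.

Lemma rsim_generates k n1 n2 (r1 : reprG n1) (r2 : reprG n2) (X : 'M_(k, n2)) :
  mx_rsim r1 r2 -> generates r2 X -> exists X' : 'M_(k, n1), generates r1 X'.
Proof.
case/mx_rsim_def=> B [B' B'K homB] genX; exists (X *m B') => w w0.
suff /(congr1 (mulmx B)): B' *m w = 0.
  rewrite mulmx0 mulmxA => <-; rewrite -[B]mulmx1 -(repr_mx1 r2).
  by rewrite -homB // repr_mx1 mul1mx.
apply: genX => g Gg; rewrite -{}[RHS](w0 g Gg) homB //.
by rewrite !mulmxA -(mulmxA X B' B) B'K mulmx1.
Qed.

Lemma rsim_cogenerates k n1 n2 (r1 : reprG n1) (r2 : reprG n2)
    (Y : 'M_(n1, k)) :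
  mx_rsim r1 r2 -> cogenerates r1 Y ->
    exists Y' : 'M_(n2, k), cogenerates r2 Y'.
Proof.
case/mx_rsim_def=> B [B' B'K homB] cogY; exists (B' *m Y) => v v0.
suff /(congr1 (mulmx^~ B)): v *m B' = 0 by rewrite mul0mx -mulmxA B'K mulmx1.
apply: cogY => g Gg; rewrite -{}[RHS](v0 g Gg) homB //.
by rewrite !mulmxA -(mulmxA v B' B) B'K mulmx1.
Qed.

End Separation.

(** * Counting homomorphisms over a finite field *)

Section FiniteHom.

Local Open Scope ring_scope.

Variables (F : finFieldType) (gT : finGroupType) (G : {group gT}).
Local Notation reprG := (mx_representation F G).

Definition hom_set m n (r : reprG m) (s : reprG n) : {set 'M[F]_(m, n)} :=
  [set f | [forall (g | g \in G), r g *m f == f *m s g]].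

Lemma hom_setP m n (r : reprG m) (s : reprG n) (f : 'M_(m, n)) :
  reflect {in G, forall g, r g *m f = f *m s g} (f \in hom_set r s).
Proof.
rewrite inE; apply: (iffP forallP) => h g => [Gg|].
  by apply/eqP; have:= h g; rewrite Gg.
by apply/implyP=> Gg; rewrite h.
Qed.

Lemma card_hom_rsim_leql m m' n (r : reprG m) (r' : reprG m') (s : reprG n) :
  mx_rsim r r' -> (#|hom_set r s| <= #|hom_set r' s|)%N.
Proof.
case/mx_rsim_def=> B [B' B'K homB].
have BK : B *m B' = 1%:M.
  by rewrite -[B]mulmx1 -(repr_mx1 r') -homB // repr_mx1.
have injB : injective (mulmx B' : 'M[F]_(m, n) -> _).
  by move=> f1 f2 /(congr1 (mulmx B)); rewrite !mulmxA BK !mul1mx.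
rewrite -(card_imset (mem (hom_set r s)) injB).
apply/subset_leq_card/subsetP=> _ /imsetP[f /hom_setP homf ->].
apply/hom_setP=> g Gg; rewrite -mulmxA -homf // homB // !mulmxA.
by rewrite B'K mul1mx.
Qed.

Lemma card_hom_rsim_leqr m n n' (r : reprG m) (s : reprG n) (s' : reprG n') :
  mx_rsim s s' -> (#|hom_set r s| <= #|hom_set r s'|)%N.
Proof.
case=> B eqn injB homB.
have injfB : injective (mulmx^~ B : 'M[F]_(m, n) -> _).
  by move=> f1 f2; apply: row_free_inj.
rewrite -(card_imset (mem (hom_set r s)) injfB).
apply/subset_leq_card/subsetP=> _ /imsetP[f /hom_setP homf ->].
by apply/hom_setP=> g Gg; rewrite mulmxA homf // -!mulmxA homB.
Qed.

Lemma card_hom_rsiml m m' n (r : reprG m) (r' : reprG m') (s : reprG n) :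
  mx_rsim r r' -> #|hom_set r s| = #|hom_set r' s|.
Proof.
move=> sim; apply/eqP; rewrite eqn_leq card_hom_rsim_leql //.
exact: card_hom_rsim_leql (mx_rsim_sym sim).
Qed.

Lemma card_hom_rsimr m n n' (r : reprG m) (s : reprG n) (s' : reprG n') :
  mx_rsim s s' -> #|hom_set r s| = #|hom_set r s'|.
Proof.
move=> sim; apply/eqP; rewrite eqn_leq card_hom_rsim_leqr //.
exact: card_hom_rsim_leqr (mx_rsim_sym sim).
Qed.

Lemma card_hom_daddl n (r1 r2 : representation F G) (s : reprG n) :
  #|hom_set (dadd_grepr r1 r2) s| = (#|hom_set r1 s| * #|hom_set r2 s|)%N.
Proof.
pose h (p : 'M[F]_(rdegree r1, n) * 'M[F]_(rdegree r2, n)) := col_mx p.1 p.2.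
have injh : injective h by move=> [a b] [c d] /eq_col_mx[/= -> ->].
rewrite -cardsX -(card_imset _ injh); apply: eq_card => f.
rewrite -[f]vsubmxK; apply/idP/imsetP.
  move=> /hom_setP homf; exists (usubmx f, dsubmx f) => //; rewrite inE.
  have homE g : g \in G ->
      r1 g *m usubmx f = usubmx f *m s g /\ r2 g *m dsubmx f = dsubmx f *m s g.
    move/homf; rewrite /= mul_block_col !mul0mx addr0 add0r mul_col_mx.
    exact: eq_col_mx.
  by apply/andP; split; apply/hom_setP=> g /homE[].
case=> -[a b]; rewrite inE /= => /andP[/hom_setP homa /hom_setP homb] ->.
apply/hom_setP=> g Gg; rewrite /= mul_block_col !mul0mx addr0 add0r.
by rewrite mul_col_mx homa ?homb.
Qed.

Lemma card_hom_daddr n (r1 r2 : representation F G) (s : reprG n) :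
  #|hom_set s (dadd_grepr r1 r2)| = (#|hom_set s r1| * #|hom_set s r2|)%N.
Proof.
pose h (p : 'M[F]_(n, rdegree r1) * 'M[F]_(n, rdegree r2)) := row_mx p.1 p.2.
have injh : injective h by move=> [a b] [c d] /eq_row_mx[/= -> ->].
rewrite -cardsX -(card_imset _ injh); apply: eq_card => f.
rewrite -[f]hsubmxK; apply/idP/imsetP.
  move=> /hom_setP homf; exists (lsubmx f, rsubmx f) => //; rewrite inE.
  have homE g : g \in G ->
      s g *m lsubmx f = lsubmx f *m r1 g /\ s g *m rsubmx f = rsubmx f *m r2 g.
    move/homf; rewrite /= mul_row_block !mulmx0 addr0 add0r mul_mx_row.
    exact: eq_row_mx.
  by apply/andP; split; apply/hom_setP=> g /homE[].
case=> -[a b]; rewrite inE /= => /andP[/hom_setP homa /hom_setP homb] ->.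
apply/hom_setP=> g Gg; rewrite /= mul_row_block !mulmx0 addr0 add0r.
by rewrite mul_mx_row homa ?homb.
Qed.

Lemma card_hom_gt0 m n (r : reprG m) (s : reprG n) : (0 < #|hom_set r s|)%N.
Proof.
apply/card_gt0P; exists 0; apply/hom_setP=> g _.
by rewrite mulmx0 mul0mx.
Qed.

Lemma card_end_gt1 n (r : reprG n) : (0 < n)%N -> (1 < #|hom_set r r|)%N.
Proof.
move=> n_gt0; apply/card_gt1P; exists 1%:M, 0; split.
- by apply/hom_setP=> g _; rewrite mulmx1 mul1mx.
- by apply/hom_setP=> g _; rewrite mulmx0 mul0mx.
by rewrite -mxrank_eq0 mxrank1 -lt0n.
Qed.

(** Schur's lemma: if [v *m f = 0], every translate of [v] is killed by a nonzero column of [f], so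
    separation forces [v = 0]. The dual argument with a nonzero row gives full rank. *)
Lemma Schur_separating m n (r : reprG m) (s : reprG n) f :
    separating r -> separating s -> f \in hom_set r s -> f != 0 ->
  row_free f /\ row_full f.
Proof.
move=> [_ sepr] [_ seps] /hom_setP homf nzf; split.
  rewrite -kermx_eq0; apply/rowV0P=> v /sub_kermxP vf0.
  case: (boolP [exists j, col j f != 0]) => [/existsP[j nzfj] | f0].
    case: (sepr v (col j f)) => // [g Gg|/eqP fj0].
      by rewrite colE !mulmxA -(mulmxA v) homf // !mulmxA vf0 !mul0mx.
    by rewrite fj0 in nzfj.
  case/negP: nzf; apply/eqP/matrixP=> i j; rewrite mxE.
  move: f0; rewrite negb_exists => /forallP/(_ j); rewrite negbK => /eqP.
  by move/matrixP/(_ i 0); rewrite !mxE.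
rewrite /row_full -mxrank_tr -[_ == n]/(row_free f^T) -kermx_eq0.
apply/rowV0P=> v /sub_kermxP /(congr1 trmx); rewrite trmx_mul trmxK trmx0.
move=> fv0; case: (boolP [exists i, row i f != 0]) => [/existsP[i nzfi] | f0].
  case: (seps (row i f) v^T) => [g Gg|/eqP fi0|/eqP].
  - by rewrite rowE -(mulmxA _ f) -homf // -!mulmxA fv0 !mulmx0.
  - by rewrite fi0 in nzfi.
  by rewrite trmx_eq0 => /eqP.
case/negP: nzf; apply/eqP/row_matrixP=> i.
by move: f0; rewrite negb_exists row0 => /forallP/(_ i); rewrite negbK => /eqP.
Qed.

(** As soon as there is a nonzero homomorphism [f], it has an inverse [f'], and [f' *m h *m f']
    embeds the homomorphisms [h] of one direction into those of the other. *)
Lemma card_hom_separating m n (r : reprG m) (s : reprG n) :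
  separating r -> separating s -> #|hom_set r s| = #|hom_set s r|.
Proof.
suff le m1 n1 (r1 : reprG m1) (s1 : reprG n1) : separating r1 ->
  separating s1 ->
    (#|hom_set r1 s1| <= #|hom_set s1 r1|)%N.
  by move=> sepr seps; apply/eqP; rewrite eqn_leq !le.
move=> sepr seps; have [f0 | nzf] := leqP #|hom_set r1 s1| 1.
  exact: leq_trans f0 (card_hom_gt0 _ _).
case/card_gt1P: nzf => f1 [f2 [hom1 hom2 ne12]].
pose f := f1 - f2.
have homf : f \in hom_set r1 s1.
  apply/hom_setP=> g Gg; rewrite mulmxBr mulmxBl.
  by rewrite (hom_setP _ _ _ hom1) // (hom_setP _ _ _ hom2).
have nzf : f != 0 by rewrite subr_eq0.
have [freef fullf] := Schur_separating sepr seps homf nzf.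
pose f' := pinvmx f.
have ff' : f *m f' = 1%:M by apply: mulmxVp.
have f'f : f' *m f = 1%:M by apply: mulVpmx.
clearbody f'.
have injf : injective (fun h : 'M[F]_(m1, n1) => f' *m h *m f').
  move=> h1 h2 /(congr1 (fun h => f *m h *m f)) /=.
  by rewrite !mulmxA ff' !mul1mx -!mulmxA f'f !mulmx1.
rewrite -(card_imset (mem (hom_set r1 s1)) injf).
have homf' g : g \in G -> s1 g *m f' = f' *m r1 g.
  move=> Gg; rewrite -[s1 g]mul1mx -f'f -(mulmxA f') -(hom_setP _ _ _ homf) //.
  by rewrite -!mulmxA ff' mulmx1.
apply/subset_leq_card/subsetP=> _ /imsetP[h /hom_setP homh ->].
apply/hom_setP=> g Gg.
by rewrite !mulmxA homf' // -!mulmxA -homf' // !mulmxA -(mulmxA f') homh //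
  !mulmxA.
Qed.

(** Both counts are multiplicative over direct sums, which reduces the claim to two simple
    modules. *)
Lemma card_hom_semisimple n (r : representation F G) (s : reprG n) :
  semisimple_repr r -> separating s -> #|hom_set r s| = #|hom_set s r|.
Proof.
move=> ssr seps; elim: ssr => {r} [r r0 | r r1 r2 sep1 _ IH2 simr].
  case: r r0 => d r /= d0; move: r; rewrite d0 => r.
  have le1 (T : finType) (A : {set T}) :
      (0 < #|A|)%N -> {in A &, forall x y, x = y} -> #|A| = 1%N.
    move=> A_gt0 eqA; apply/eqP; rewrite eqn_leq A_gt0 andbT.
    by apply/card_le1P=> x Ax y; rewrite inE; apply/idP/eqP=> [Ay|->] //;
      apply: eqA.
  have -> : #|hom_set r s| = 1%N.
    by apply: le1 => [|f g _ _]; rewrite ?card_hom_gt0 // [f]flatmx0 [g]flatmx0.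
  apply/esym/le1 => [|f g _ _]; first exact: card_hom_gt0.
  by rewrite [f]thinmx0 [g]thinmx0.
rewrite (card_hom_rsiml _ simr) (card_hom_rsimr _ simr).
by rewrite card_hom_daddl card_hom_daddr IH2 (card_hom_separating sep1).
Qed.

(** Its columns are the translates of [w], so its left kernel consists of the vectors whose pairing
    with every translate vanishes. *)
Definition orbit_mx n (r : reprG n) (w : 'cV[F]_n) : 'M_(n, #|G|) :=
  \matrix_(i, j) (r (enum_val j) *m w) i 0.

Lemma col_orbit_mx m n (r : reprG n) w (A : 'M_(m, n)) j :
  col j (A *m orbit_mx r w) = A *m r (enum_val j) *m w.
Proof.
by rewrite -mulmxA; apply/colP=> i; rewrite !mxE; apply: eq_bigr => l _;
  rewrite !mxE.
Qed.

Lemma col_inj m n (A B : 'M[F]_(m, n)) : (forall j, col j A = col j B) -> A = B.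
Proof.
by move=> eqAB; apply/matrixP=> i j; move/colP/(_ i): (eqAB j); rewrite !mxE.
Qed.

(* If (s, x2) does not generate, the columns killed by it form the graph of a *)
(* homomorphism theta with x2 *m theta = s. *)
Lemma generates_dadd k (r1 r2 : representation F G)
    (s : 'M_(k, rdegree r1)) (x2 : 'M_(k, rdegree r2)) :
    separating r1 -> generates r2 x2 ->
    (forall theta, theta \in hom_set r2 r1 -> x2 *m theta != s) ->
  generates (dadd_grepr r1 r2) (row_mx s x2).
Proof.
move=> [n1_gt0 sep1] gen2 no_s w.
rewrite -[w]vsubmxK; set w1 : 'cV_(rdegree r1) := usubmx w.
set w2 : 'cV_(rdegree r2) := dsubmx w => kill_w.
have{}kill_w g : g \in G -> s *m r1 g *m w1 + x2 *m r2 g *m w2 = 0.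
  move/kill_w; rewrite /= mul_row_block !mulmx0 addr0 add0r mul_row_col.
  by rewrite -!mulmxA.
have [w10 | nzw1] := eqVneq w1 0.
  rewrite w10 (gen2 w2) ?col_mx0 // => g /kill_w.
  by rewrite w10 mulmx0 add0r.
pose O1 := orbit_mx r1 w1; pose O2 := orbit_mx r2 w2.
have O1_free : row_free O1.
  rewrite -kermx_eq0; apply/rowV0P=> v /sub_kermxP vO1.
  case: (sep1 v w1) => // [g Gg|/eqP]; last by rewrite (negPf nzw1).
  by rewrite -(enum_rankK_in Gg Gg) -col_orbit_mx vO1; apply/colP=> i;
    rewrite !mxE.
have kill_O g : g \in G -> x2 *m r2 g *m O2 = - (s *m r1 g *m O1).
  move=> Gg; apply: col_inj => j; rewrite linearN /= !col_orbit_mx.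
  have Gj := enum_valP j; apply/eqP; rewrite -addr_eq0 addrC; apply/eqP.
  by rewrite -(mulmxA s) -(mulmxA x2) -!repr_mxM // kill_w ?groupM.
(* Since [x2] generates, every linear relation among the translates of [w1] also holds among those
   of [w2]. Hence sending the former to minus the latter is a well-defined linear map, the [theta]
   below. *)
have O2_ker (c : 'cV_#|G|) : O1 *m c = 0 -> O2 *m c = 0.
  move=> O1c; apply: gen2 => g Gg.
  by rewrite mulmxA kill_O // mulNmx -(mulmxA _ O1) O1c mulmx0 oppr0.
have O2E : O2 *m pinvmx O1 *m O1 = O2.
  apply: col_inj => j; rewrite !colE; set e := delta_mx j 0.
  apply/eqP; rewrite -subr_eq0; apply/eqP.
  have -> : O2 *m pinvmx O1 *m O1 *m e - O2 *m e =
      O2 *m (pinvmx O1 *m O1 *m e - e) by rewrite mulmxBr !mulmxA.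
  apply: O2_ker; rewrite mulmxBr -(mulmxA _ O1) (mulmxA O1) mulmxVp //.
  by rewrite mul1mx subrr.
pose theta := - (O2 *m pinvmx O1).
have thetaO : theta *m O1 = - O2 by rewrite mulNmx O2E.
have injO1 m : injective (mulmx^~ O1 : 'M[F]_(m, _) -> _) by apply:
  row_free_inj.
have theta_col g : g \in G -> theta *m (r1 g *m w1) = - (r2 g *m w2).
  move=> Gg; move/(congr1 (col (enum_rank_in Gg g))): thetaO.
  rewrite linearN /= -[O2]mul1mx !col_orbit_mx enum_rankK_in //.
  by rewrite mul1mx -!mulmxA.
have homtheta : theta \in hom_set r2 r1.
  apply/hom_setP=> g Gg; apply: injO1; rewrite -mulmxA thetaO.
  apply: col_inj => j; have Gj := enum_valP j.
  rewrite mulmxN linearN /= !col_orbit_mx -(mulmxA theta (r1 g)).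
  by rewrite -!repr_mxM // -(mulmxA theta) theta_col ?groupM.
case/eqP: (no_s theta homtheta); apply: injO1; rewrite -mulmxA thetaO mulmxN.
by have:= kill_O 1%g (group1 G); rewrite !repr_mx1 !mulmx1 => ->; rewrite opprK.
Qed.

Lemma semisimple_generates k (r : representation F G) (Y : 'M_(rdegree r, k)) :
  semisimple_repr r -> cogenerates r Y -> exists X : 'M_(k, _), generates r X.
Proof.
move=> ssr; elim: ssr Y => {r} [r r0 | r r1 r2 sep1 ss2 IH2 simr] Y cogY.
  exists 0 => w _; move: w; rewrite r0 => w; exact: flatmx0.
have [{cogY}Y cogY] := rsim_cogenerates simr cogY.
suff [X genX] : exists X : 'M_(k, _), generates (dadd_grepr r1 r2) X.
  exact: rsim_generates simr genX.
have [|x2 gen2] := IH2 (dsubmx (Y : 'M_(rdegree r1 + rdegree r2, k))).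
  move=> v v0; suff : row_mx (0 : 'rV_(rdegree r1)) v = 0.
    by rewrite -[RHS]row_mx0 => /eq_row_mx[].
  apply: cogY => g Gg.
  rewrite /= mul_row_block !mulmx0 mul0mx addr0 add0r -[Y]vsubmxK.
  by rewrite mul_row_col mul0mx add0r v0.
pose H12 := hom_set r1 (dadd_grepr r1 r2).
(* A homomorphism from [r1] is determined by its composite with [Y], because [Y] cogenerates. *)
have leH : (#|H12| <= #|{: 'M[F]_(k, rdegree r1)}|)%N.
  have -> : #|{: 'M[F]_(k, rdegree r1)}| = #|{: 'M[F]_(rdegree r1, k)}|.
    by rewrite !card_mx mulnC.
  have injY : {in H12 &, injective (mulmx^~ Y)}.
    move=> f1 f2 /hom_setP hom1 /hom_setP hom2 eqf.
    apply/eqP; rewrite -subr_eq0; apply/eqP/row_matrixP=> i; rewrite row0.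
    apply: cogY => g Gg; rewrite rowE -!mulmxA (mulmxA _ _ Y) mulmxBl.
    by rewrite -hom1 // -hom2 // -mulmxBr -mulmxA mulmxBl eqf subrr !mulmx0.
  by rewrite -(card_in_imset injY) max_card.
(* Strictness comes from the endomorphisms of [r1], among which 0 and 1 are distinct. *)
have ltH : (#|hom_set r2 r1| < #|{: 'M[F]_(k, rdegree r1)}|)%N.
  rewrite card_hom_semisimple //; apply: leq_trans leH.
  rewrite card_hom_daddr -[ltnLHS]mul1n ltn_pmul2r ?card_hom_gt0 //.
  by apply: card_end_gt1; case: sep1.
have [s no_s] : exists s, s \notin [set x2 *m theta | theta in hom_set r2 r1].
  apply/existsP; rewrite -negb_forall; apply: contraL ltH => /forallP allS.
  rewrite -leqNgt; apply: leq_trans (leq_imset_card (mulmx x2) _).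
  by apply/subset_leq_card/subsetP=> s _; apply: allS.
exists (row_mx s x2); apply: generates_dadd => // theta homtheta.
by apply: contraNneq no_s => <-; apply: imset_f.
Qed.

Lemma semisimple_cogenerates k (r : representation F G)
    (X : 'M_(k, rdegree r)) :
  semisimple_repr r -> generates r X -> exists Y : 'M_(_, k), cogenerates r Y.
Proof.
move=> ssr /generates_dual /(semisimple_generates (semisimple_dual ssr))[Y].
by move/generates_of_dual; exists Y^T.
Qed.

End FiniteHom.

(** * Normal generation *)

Section NormalGeneration.

Variables (gT : finGroupType) (G : {group gT}).
Implicit Types H K L M : {group gT}.

Lemma normal_k_generatedP H k : H <| G ->
  normal_k_generated G H k <->
  exists x : 'I_k -> gT, (forall i, x i \in H) /\
    forall L, L <| G -> (forall i, x i \in L) -> H \subset L.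
Proof.
move=> nsHG; split=> [[x defH] | [x [Hx genH]]]; exists x.
  split=> [i | L /normal_norm nLG Lx].
    rewrite defH mem_gen // -[x i]conjg1; apply: imset2_f (group1 G).
    exact: imset_f.
  rewrite defH gen_subG class_support_sub_norm //.
  by apply/subsetP=> _ /imsetP[i _ ->].
have sXH : <<class_support [set x i | i : 'I_k] G>> \subset H.
  rewrite gen_subG class_support_sub_norm ?normal_norm //.
  by apply/subsetP=> _ /imsetP[i _ ->].
apply/eqP; rewrite eqEsubset sXH andbT.
apply: (genH [group of <<class_support [set x i | i : 'I_k] G>>]) => [|i].
  rewrite /normal /= (subset_trans sXH (normal_sub nsHG)).
  by rewrite norms_gen ?class_support_norm.
rewrite mem_gen // -[x i]conjg1; apply: imset2_f (group1 G).
exact: imset_f.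
Qed.

Lemma min_normalP M : min_normal G M ->
  [/\ M :!=: 1, M <| G
    & forall H, H <| G -> H \subset M -> H :!=: 1 -> M \subset H].
Proof.
case/mingroupP=> /andP[ntM nsMG] minM; split=> // H nsHG sHM ntH.
by rewrite (minM H) ?ntH.
Qed.

Lemma min_normal_exists H :
  H <| G -> H :!=: 1 -> exists2 M, min_normal G M & M \subset H.
Proof.
move=> nsHG ntH; case: (@mingroup_exists _ (fun L => (L :!=: 1) && (L <| G)) H).
  by rewrite ntH.
by move=> M minM sMH; exists M.
Qed.

Lemma min_normal_sub M L :
  min_normal G M -> G \subset 'N(L) -> M :&: L != 1 -> M \subset L.
Proof.
move=> /min_normalP[_ nsMG minM] nLG ntML.
have nsI : M :&: L <| G.
  rewrite /normal (subset_trans (subsetIl _ _) (normal_sub nsMG)).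
  by rewrite normsI // normal_norm.
exact: subset_trans (minM [group of M :&: L] nsI (subsetIl _ _) ntML)
  (subsetIr _ _).
Qed.

Lemma min_normal_socle M : min_normal G M -> M \subset socle_of G.
Proof.
by move=> minM; apply: subset_trans (subset_gen _); apply: bigcup_sup minM.
Qed.

Lemma min_normal_abelian_socle M :
  min_normal G M -> abelian M -> M \subset abelian_socle G.
Proof.
move=> minM abM; apply: subset_trans (subset_gen _).
by apply: (bigcup_sup M); rewrite minM.
Qed.

Lemma abelian_socle_sub : abelian_socle G \subset socle_of G.
Proof.
by rewrite gen_subG; apply/bigcupsP=> M /andP[/min_normal_socle].
Qed.

Lemma gen_normal_normal (P : pred {group gT}) :
  (forall M, P M -> min_normal G M) ->
    <<\bigcup_(M : {group gT} | P M) M>> <| G.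
Proof.
move=> minP; rewrite /normal gen_subG; apply/andP; split.
  by apply/bigcupsP=> M /minP/min_normalP[_ /normal_sub].
apply: norms_gen; apply: norms_bigcup; apply/bigcapsP=> M.
by move/minP/min_normalP=> [_ /normal_norm].
Qed.

Lemma socle_normal : socle_of G <| G.
Proof. exact: gen_normal_normal. Qed.

Lemma abelian_socle_normal : abelian_socle G <| G.
Proof. by apply: gen_normal_normal => M /andP[]. Qed.

Lemma socle_compl H : H <| G -> H \subset socle_of G ->
  exists K, [/\ K <| G, H :&: K = 1 & socle_of G \subset H * K].
Proof.
move=> nsHG sHS.
pose P K := (K <| G) && (H :&: K \subset [1]).
have [K /maxgroupP[/andP[nsKG tiHK] maxK] _] :
  {K : {group gT} | maxgroup K P & 1%G \subset K}.
  by apply: maxgroup_exists; rewrite /P normal1 subsetIr.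
exists K; split=> //; first exact/trivgP.
have nsHKG : H <*> K <| G by rewrite normalY.
have defHK : H <*> K = H * K.
  by rewrite norm_joinEr // (subset_trans (normal_sub nsKG)) ?normal_norm.
rewrite -defHK gen_subG; apply/bigcupsP=> M minM.
have [_ nsMG _] := min_normalP minM.
have [tiM | ntM] := eqVneq (M :&: (H <*> K)) 1; last first.
  by apply: (min_normal_sub minM) ntM; apply: normal_norm.
suff /maxK eqK : P (K <*> M)%G.
  by rewrite (subset_trans _ (joing_subr H K)) // -eqK ?joing_subl ?joing_subr.
rewrite /P normalY //=; apply/subsetP=> x /setIP[Hx].
rewrite norm_joinEr ?(subset_trans (normal_sub nsMG)) ?normal_norm //.
case/mulsgP=> y z Ky Mz def_x.
have z1 : z = 1.
  apply/set1gP; rewrite -tiM inE Mz -(mulKg y z) -def_x groupM //.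
    by rewrite groupV (subsetP (joing_subr H K)).
  exact: (subsetP (joing_subl H K)).
by rewrite def_x z1 mulg1 in Hx *; apply: (subsetP tiHK); rewrite inE Hx.
Qed.

(** A complement of [H :&: L] in the socle meets [H] trivially, since a minimal normal subgroup in
    that intersection would also lie in [L]. *)
Lemma socle_sub_gen H L : H <| G -> H \subset socle_of G -> G \subset 'N(L) ->
  (forall M, min_normal G M -> M \subset H -> M \subset L) -> H \subset L.
Proof.
move=> nsHG sHS nLG minL.
have nsHL : H :&: L <| G.
  by rewrite /normal (subset_trans (subsetIl _ _) (normal_sub nsHG)) normsI //
    normal_norm.
have [K [nsKG tiK defS]] := socle_compl nsHL (subset_trans (subsetIl _ _) sHS).
have tiKH : K :&: H = 1.
  apply/eqP/idPn => ntKH.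
  have [M minM /subsetIP[sMK sMH]] :=
    min_normal_exists (normalI nsKG nsHG) ntKH.
  case/min_normalP: (minM) => /negP[]; rewrite -subG1 -tiK subsetI sMK andbT.
  by rewrite subsetI sMH minL.
apply/subsetP=> x Hx; have := subsetP (subset_trans sHS defS) x Hx.
case/mulsgP=> y z /setIP[Hy Ly] Kz def_x.
have /set1gP z1 : z \in [1] by rewrite -tiKH inE Kz -(mulKg y z) -def_x groupM
  ?groupV.
by rewrite def_x z1 mulg1.
Qed.

(* H has a normal complement in the socle, so H is an image of J. *)
Lemma normal_k_generatedS (H J : {group gT}) k :
    H <| G -> J <| G -> H \subset J -> J \subset socle_of G ->
  normal_k_generated G J k -> normal_k_generated G H k.
Proof.
move=> nsHG nsJG sHJ sJS /(normal_k_generatedP _ nsJG)[x [Jx genJ]].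
have [K [nsKG tiHK defS]] := socle_compl nsHG (subset_trans sHJ sJS).
have HKx i : x i \in H * K by rewrite (subsetP defS) ?(subsetP sJS).
apply/normal_k_generatedP => //; exists (fun i => divgr H K (x i)).
split=> [i | L nsLG Lx]; first exact: mem_divgr.
have nKHL : H :&: L \subset 'N(K).
  apply: subset_trans (subsetIl _ _) (subset_trans (normal_sub nsHG) _).
  exact: normal_norm.
have sJHLK : J \subset (H :&: L) <*> K.
  apply: genJ => [|i]; first by rewrite normalY ?normalI.
  rewrite (divgr_eq H K (x i)) groupM //.
    by apply: (subsetP (joing_subl _ _)); rewrite inE Lx mem_divgr.
  by apply: (subsetP (joing_subr _ _)); rewrite mem_remgr.
rewrite norm_joinEl // in sJHLK.
apply/subsetP=> h Hh; have := subsetP (subset_trans sHJ sJHLK) h Hh.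
case/mulsgP=> y z /setIP[Hy Ly] Kz def_h.
have /set1gP z1 : z \in [1] by rewrite -tiHK inE Kz andbT -(mulKg y z) -def_h
  groupM ?groupV.
by rewrite def_h z1 mulg1.
Qed.

(** The commutator subgroup lies in both groups; were it nontrivial, minimality would identify it
    with each of them. *)
Lemma nonabelian_min_normal_cent M M' :
  min_normal G M -> min_normal G M' -> M != M' -> M' \subset 'C(M).
Proof.
move=> minM minM' neqM; apply/commG1P; apply: contraNeq neqM => ntMM'.
have [[_ nsMG minMs] [_ nsM'G minM's]] := (min_normalP minM, min_normalP minM').
have sRM : [~: M', M] \subset M.
  by rewrite commg_subr (subset_trans (normal_sub nsM'G)) ?normal_norm.
have sRM' : [~: M', M] \subset M'.
  by rewrite commg_subl (subset_trans (normal_sub nsMG)) ?normal_norm.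
have nsRG : [~: M', M] <| G.
  rewrite /normal (subset_trans sRM (normal_sub nsMG)).
  by rewrite normsR ?normal_norm.
have sMR := minMs [group of [~: M', M]] nsRG sRM ntMM'.
have sM'R := minM's [group of [~: M', M]] nsRG sRM' ntMM'.
by rewrite -val_eqE eqEsubset (subset_trans sMR) ?(subset_trans sM'R).
Qed.

Lemma abelian_socle_cent M : min_normal G M -> abelian_socle G \subset 'C(M).
Proof.
move=> minM; rewrite gen_subG; apply/bigcupsP=> M1 /andP[min1 ab1].
exact: min_normal_cent min1 minM ab1.
Qed.

Variable N : {group gT}.
Hypothesis nsNG : N <| G.
Let A := abelian_socle G.
Let S := socle_of G.

(** Used with [C] a centraliser to isolate one factor of a product of possibly noncommuting
    elements. *)
Lemma prod_mem_index (I : eqType) (C : {group gT}) (f : I -> gT) (r : seq I) j :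
    uniq r -> j \in r -> (forall i, i \in r -> i != j -> f i \in C) ->
  \prod_(i <- r) f i \in C -> f j \in C.
Proof.
elim: r => //= i r IHr /andP[r'i Ur]; rewrite inE big_cons => rj Cf.
have [eq_ji | neq_ji] := eqVneq j i.
  rewrite -eq_ji groupMr // big_seq; apply: group_prod => l rl.
  by rewrite Cf ?inE ?rl ?orbT //; apply: contraNneq r'i => eq_lj;
    rewrite -eq_ji -eq_lj.
have Ci : f i \in C by rewrite Cf ?inE ?eqxx // eq_sym.
rewrite (negPf neq_ji) /= in rj; rewrite groupMl //.
by apply: IHr => // l rl; apply: Cf; rewrite inE rl orbT.
Qed.

(* The first generator a is multiplied by a product of elements t M of the *)
(* nonabelian minimal normal subgroups M of G inside N, with t M not central: *)
(* since a and the other factors centralise M, the normal closure meets M. *)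
Lemma normal_k_generated_socle k : (0 < k)%N ->
  normal_k_generated G (A :&: N) k -> normal_k_generated G (S :&: N) k.
Proof.
case: k => // k _.
have nsAN : A :&: N <| G by rewrite normalI ?abelian_socle_normal.
have nsSN : S :&: N <| G by rewrite normalI ?socle_normal.
case/(normal_k_generatedP _ nsAN) => a [ANa genA].
apply/(normal_k_generatedP _ nsSN).
pose P M := [&& min_normal G M, ~~ abelian M & M \subset N].
(* The default 1 is never reached under [P], since a nonabelian [M] has an element that does not
   centralise it. *)
pose t M := odflt 1 [pick t in M | t \notin 'C(M)].
have tP M : P M -> t M \in M /\ t M \notin 'C(M).
  case/and3P=> _ /subsetPn[u Mu nCu] _; rewrite /t.
  by case: pickP => [v /andP[] | /(_ u)] //=; rewrite Mu nCu.
have Mt M : P M -> t M \in M by case/tP.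
have nCt M : P M -> t M \notin 'C(M) by case/tP.
pose T := \prod_(M <- enum P) t M.
exists (fun i => if i == ord0 then a ord0 * T else a i);
  split=> [i | L nsLG Lx].
  have SNa j : a j \in S :&: N.
    by apply: subsetP (ANa j); rewrite setSI ?abelian_socle_sub.
  case: eqP => // _; rewrite groupM //.
  rewrite /T big_seq; apply: group_prod => M; rewrite mem_enum => PM.
  case/and3P: (PM) => minM _ sMN; rewrite inE (subsetP sMN) ?Mt // andbT.
  exact: subsetP (min_normal_socle minM) _ (Mt M PM).
have nabL M : P M -> M \subset L.
  move=> PM; case/and3P: (PM) => minM _ _;
    apply: (min_normal_sub minM (normal_norm nsLG)).
  apply: contra (nCt M PM) => /eqP tiML.
  have cLM : L \subset 'C(M).
    have [_ nsMG _] := min_normalP minM.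
    have nML := subset_trans (normal_sub nsLG) (normal_norm nsMG).
    have nLM := subset_trans (normal_sub nsMG) (normal_norm nsLG).
    by apply/commG1P/trivgP; rewrite -tiML subsetI commg_subl commg_subr nML.
  apply: (prod_mem_index (I := {group gT}) (f := t) (enum_uniq P)).
  - by rewrite mem_enum.
  - move=> M'; rewrite mem_enum => PM' neqM'; case/and3P: (PM') => minM' _ _.
    apply: subsetP (Mt M' PM'); rewrite nonabelian_min_normal_cent //.
    by rewrite eq_sym.
  rewrite -/T -(@groupMl _ _ (a ord0)); first exact: subsetP cLM _ (Lx ord0).
  have /setIP[Aa _] := ANa ord0.
  exact: subsetP (abelian_socle_cent minM) _ Aa.
have LT : T \in L.
  rewrite /T big_seq; apply: group_prod => M; rewrite mem_enum => PM.
  exact: subsetP (nabL M PM) _ (Mt M PM).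
have sANL : A :&: N \subset L.
  apply: genA => // i; have := Lx i; case: eqP => // ->.
  by rewrite groupMr.
apply: (socle_sub_gen nsSN (subsetIl _ _) (normal_norm nsLG)) => M minM.
rewrite subsetI => /andP[_ sMN].
have [abM | nabM] := boolP (abelian M); last by apply: nabL; apply/and3P.
by apply: subset_trans sANL; rewrite subsetI min_normal_abelian_socle.
Qed.

End NormalGeneration.

(** * Assembling generators of the primary parts *)

Section PrimaryParts.

Variables (gT : finGroupType) (G N : {group gT}).
Hypothesis nsNG : N <| G.
Let A := abelian_socle G.

Lemma constt_prod (I : Type) (r : seq I) (B : {group gT}) (x : I -> gT) pi :
    abelian B -> (forall i, x i \in B) ->
  (\prod_(i <- r) x i).`_pi = \prod_(i <- r) (x i).`_pi.
Proof.
move=> abB Bx; elim: r => [|i r IHr]; first by rewrite !big_nil constt1.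
rewrite !big_cons consttM ?IHr //; apply: (centsP abB) => //.
exact: group_prod.
Qed.

Lemma min_normal_pcore M : min_normal G M -> abelian M ->
  exists p, [/\ prime p, (p %| #|A|)%N & M \subset 'O_p(A)].
Proof.
move=> minM abM; have [ntM nsMG _] := min_normalP minM.
have [_ _ /is_abelemP[p pr_p abelM]] :=
  minnormal_solvable (min_normal_minnormal minM) (subxx _) (abelian_sol abM).
have sMA := min_normal_abelian_socle minM abM.
have pM := abelem_pgroup abelM.
exists p; split=> //.
  have [_ p_dv_M _] := pgroup_pdiv pM ntM.
  exact: dvdn_trans p_dv_M (cardSg sMA).
apply: pcore_max => //; rewrite /normal sMA.
exact: subset_trans (normal_sub (abelian_socle_normal G)) (normal_norm nsMG).
Qed.

(** The [i]-th generators for the different primes are multiplied together. Each is the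
    [p]-constituent of the product, hence a power of it, and is recovered in any subgroup containing
    the product. *)
Lemma normal_k_generated_primes k :
  (forall p, prime p -> (p %| #|A|)%N ->
    normal_k_generated G ('O_p(A) :&: N) k) ->
  normal_k_generated G (A :&: N) k.
Proof.
move=> genO; have nsAN : A :&: N <| G by rewrite normalI ?abelian_socle_normal.
have nsON p : 'O_p(A) :&: N <| G.
  by rewrite normalI // gFnormal_trans ?abelian_socle_normal.
pose good p := prime p && (p %| #|A|)%N.
(* Indices that are not prime divisors of [#|A|] receive the trivial family as a default. *)
have exO (p : 'I_(#|A|.+1)) : exists x : 'I_k -> gT,
    (forall i, x i \in 'O_p(A) :&: N) /\
      (good p -> forall L : {group gT}, L <| G -> (forall i, x i \in L) ->
         'O_p(A) :&: N \subset L).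
  case: (boolP (good p)) => [/andP[pr_p p_dv] | _].
    have /(normal_k_generatedP _ (nsON p))[x [Ox genx]] := genO p pr_p p_dv.
    by exists x.
  by exists (fun _ => 1); split=> // i; apply: group1.
have [x xP] := fin_all_exists exO.
apply/(normal_k_generatedP _ nsAN).
have Ax p i : x p i \in A :&: N.
  by have [/(_ i) + _] := xP p; apply: subsetP; rewrite setSI ?pcore_sub.
exists (fun i => \prod_p x p i); split=> [i | L nsLG La].
  by apply: group_prod.
apply: (socle_sub_gen nsAN _ (normal_norm nsLG)) => [|M minM].
  by rewrite (subset_trans (subsetIl _ _)) ?abelian_socle_sub.
rewrite subsetI => /andP[sMA sMN].
have abM : abelian M := abelianS sMA (abelian_socle_abelian G).
have [p [pr_p p_dv sMO]] := min_normal_pcore minM abM.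
have p_le : p < #|A|.+1 by rewrite ltnS dvdn_leq ?cardG_gt0.
pose p' := Ordinal p_le; have [xO genx] := xP p'.
suff sOL : 'O_p(A) :&: N \subset L.
  by rewrite (subset_trans _ sOL) // subsetI sMO.
apply: genx => // [|i]; first by rewrite /good pr_p.
suff -> : x p' i = (\prod_q x q i).`_p by rewrite groupX.
rewrite (constt_prod _ _ (abelianS (subsetIl _ _) (abelian_socle_abelian G))
  (fun q => Ax q i)).
rewrite (eq_bigr (fun q => if q == p' then x p' i else 1)) => [|q _].
  by rewrite -big_mkcond big_pred1_eq.
have [/(_ i) /setIP[Oq _] _] := xP q.
have pq := mem_p_elt (pcore_pgroup _ _) Oq.
case: eqP => [eq_qp | /eqP neq_qp].
  by rewrite eq_qp in pq *; rewrite constt_p_elt.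
apply/constt1P; apply: sub_in_pnat pq => r _ /=; rewrite !inE => /eqP->.
exact: neq_qp.
Qed.

End PrimaryParts.

(** * Submodules as normal subgroups *)

Section ModuleGeneration.

Variables (gT : finGroupType) (G E : {group gT}) (R : pzRingType).
Variables (V : lmodType R) (act : V -> gT -> V) (val : V -> gT).
Hypothesis nsEG : E <| G.
Hypothesis valD : {morph val : u v / (u + v)%R >-> u * v}.
Hypothesis val_inj : injective val.
Hypothesis val_in : forall v, val v \in E.
Hypothesis val_onto : forall x, x \in E -> exists v, val v = x.
Hypothesis val_act : {in G, forall g v, val (act v g) = val v ^ g}.
Hypothesis val_scale : forall a v, val (a *: v)%R \in <[val v]>.

(** An abstract ring covers the integers and ['F_p] at once: by [val_scale] scalars act through
    powers, so submodules correspond to normal subgroups of [G] inside [E]. *)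
Lemma module_k_generatedP k :
  module_k_generated G act k <-> normal_k_generated G E k.
Proof.
have val0 : val 0%R = 1 by apply: (mulIg (val 0%R)); rewrite -valD addr0 mul1g.
split=> [[x genx] | [y defE]].
  apply/(normal_k_generatedP _ nsEG); exists (fun i => val (x i)).
  split=> // L nsLG Lx; apply/subsetP=> e /val_onto[v <-].
  have [r ->] := genx v; rewrite (big_morph _ valD val0);
    apply: group_prod => i _.
  rewrite (big_morph _ valD val0); apply: group_prod => g Gg.
  apply: subsetP (val_scale _ _); rewrite cycle_subG val_act //.
  by rewrite memJ_norm // (subsetP (normal_norm nsLG)).
have Ey i : y i \in E.
  rewrite defE mem_gen // -[y i]conjg1; apply: imset2_f (group1 G).
  exact: imset_f.
have [x val_x] := fin_all_exists (fun i => val_onto (Ey i)).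
exists x; pose P v := exists r, v =
  (\sum_(i < k) gring_act G act (r i) (x i))%R.
have PD u v : P u -> P v -> P (u + v)%R.
  case=> [r ->] [s ->]; exists (fun i g => r i g + s i g)%R.
  rewrite -big_split; apply: eq_bigr => i _; rewrite -big_split.
  by apply: eq_bigr => g _; rewrite scalerDl.
have P0 : P 0%R.
  exists (fun _ _ => 0%R); rewrite big1 // => i _.
  by apply: big1 => g _; rewrite scale0r.
have Px i g : g \in G -> P (act (x i) g).
  move=> Gg; exists (fun j h => ((j == i) && (h == g))%:R)%R.
  rewrite (bigD1 i) //= {1}/gring_act (bigD1 g) //= !eqxx scale1r.
  rewrite big1 => [|h /andP[_ /negPf->]]; last by rewrite scale0r.
  rewrite addr0 big1 ?addr0 // => j /negPf->.
  by apply: big1 => h _; rewrite scale0r.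
move=> v; have := val_in v; rewrite {1}defE => /gen_prodgP[n [c Cc def_v]].
have exu j : exists u, P u /\ val u = c j.
  case/imset2P: (Cc j) => _ g /imsetP[i _ ->] Gg ->.
  by exists (act (x i) g); split; [apply: Px | rewrite val_act ?val_x].
have [u uP] := fin_all_exists exu.
have -> : v = (\sum_j u j)%R.
  apply: val_inj; rewrite def_v (big_morph _ valD val0).
  by apply: eq_bigr => j _; case: (uP j).
by apply: (big_ind P) => // j _; case: (uP j).
Qed.

End ModuleGeneration.

Section Conjugation.

Variables (gT : finGroupType) (G E : {group gT}) (k : nat).
Hypothesis nsEG : E <| G.

Lemma ZG_k_generatedP (abE : abelian E) :
  ZG_k_generated G k abE <-> normal_k_generated G E k.
Proof.
have nEG := subsetP (normal_norm nsEG).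
apply: (@module_k_generatedP _ G E int (zmodule (fmod_of abE)) _ fmval) => //.
- exact: fmod_inj.
- exact: fmodP.
- by move=> x Ex; exists (fmod abE x); apply: fmodK.
- by move=> g Gg v; apply: fmvalJ (nEG g Gg).
case=> n v; rewrite ?NegzE ?scaleNr.
  by rewrite [X in X \in _](fmvalZ n (v : fmod_of abE)) mem_cycle.
rewrite [X in X \in _](fmvalN _) groupV.
by rewrite [X in X \in _](fmvalZ n.+1 (v : fmod_of abE)) mem_cycle.
Qed.

Lemma FpG_k_generatedP p (pr_p : prime p) (abelE : p.-abelem E) :
  FpG_k_generated G k pr_p abelE <-> normal_k_generated G E k.
Proof.
have nEG := subsetP (normal_norm nsEG).
pose V := fmod_of (abelem_abelian abelE).
apply: (@module_k_generatedP _ G E 'F_p (fpmod_of pr_p abelE) _ fmval) => //.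
- exact: fmod_inj.
- exact: fmodP.
- by move=> x Ex; exists (fmod (abelem_abelian abelE) x); apply: fmodK.
- by move=> g Gg v; apply: fmvalJ (nEG g Gg).
by move=> a v; rewrite [X in X \in _](fmvalZ a (v : V)) mem_cycle.
Qed.

End Conjugation.

(** * Elementary abelian normal subgroups *)

(** Over an arbitrary field [mxsimple_exists] yields a simple submodule only classically; excluded
    middle removes the modality. *)
Lemma classically_Prop (P : Prop) : classically P -> P.
Proof. by move/classicP; apply: NNPP. Qed.

Section AbelemModule.

Local Open Scope abelem_scope.

Variables (gT : finGroupType) (G E : {group gT}) (p : nat).
Hypotheses (nsEG : E <| G) (abelE : p.-abelem E) (ntE : E :!=: 1).
Let nEG := normal_norm nsEG.
Local Notation ErV := (abelem_rV abelE ntE).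
Local Notation rV_E := (rVabelem abelE ntE).
Local Notation rG := (abelem_repr abelE ntE nEG).

(** The core in [G] of the intersection of the kernels of the [k] functionals on [E] given by the
    columns of [Y]. *)
Definition joint_kernel k (Y : 'M['F_p]_('dim E, k)) : {set gT} :=
  [set x in E | [forall g in G, ErV (x ^ g) *m Y == 0]%R].

Lemma joint_kernelP k (Y : 'M['F_p]_('dim E, k)) x :
  reflect (x \in E /\ {in G, forall g, ErV (x ^ g) *m Y = 0}%R)
          (x \in joint_kernel Y).
Proof.
rewrite inE; apply: (iffP andP) => -[Ex h]; split=> //.
  by move=> g Gg; apply/eqP; apply: (forall_inP h).
by apply/forall_inP=> g Gg; rewrite h.
Qed.

Lemma joint_kernel_group_set k (Y : 'M_(_, k)) : group_set (joint_kernel Y).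
Proof.
apply/group_setP; split=> [|x y /joint_kernelP[Ex hx] /joint_kernelP[Ey hy]].
  apply/joint_kernelP; split=> // g _.
  by rewrite conj1g abelem_rV_1 mul0mx.
apply/joint_kernelP; split=> [|g Gg]; first exact: groupM.
rewrite conjMg morphM ?memJ_norm ?(subsetP nEG) //.
by rewrite mulmxDl hx ?hy ?addr0.
Qed.
Definition joint_kernel_group k (Y : 'M_(_, k)) :=
  Group (joint_kernel_group_set Y).

Lemma joint_kernel_normal k (Y : 'M_(_, k)) : joint_kernel Y <| G.
Proof.
have sKE : joint_kernel Y \subset E by apply/subsetP=> x /joint_kernelP[].
rewrite /normal (subset_trans sKE (normal_sub nsEG)).
apply/subsetP=> g Gg; rewrite inE;
  apply/subsetP=> _ /imsetP[x /joint_kernelP[Ex hx] ->].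
apply/joint_kernelP; split=> [|h Gh]; first by rewrite memJ_norm ?(subsetP nEG).
by rewrite -conjgM hx ?groupM.
Qed.

Lemma cogenerates_joint_kernel k (Y : 'M_(_, k)) :
  cogenerates rG Y <-> joint_kernel Y \subset [1].
Proof.
split=> [cogY | trivK v v0].
  apply/subsetP=> x /joint_kernelP[Ex hx].
  have : ErV x = 0%R.
    by apply: cogY => g Gg; rewrite -(abelem_rV_J abelE ntE nEG) // hx.
  by move/(congr1 rV_E); rewrite abelem_rV_K // rVabelem0 => ->; rewrite inE.
have : rV_E v \in joint_kernel Y.
  apply/joint_kernelP; split=> [|g Gg]; first exact: mem_rVabelem.
  by rewrite (abelem_rV_J abelE ntE nEG) ?mem_rVabelem // rVabelemK v0.
move/(subsetP trivK)/set1gP; rewrite -(rVabelem0 abelE ntE).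
exact: rVabelem_inj.
Qed.

(** A functional vanishing on all translates of the generators has a normal joint kernel containing
    them, hence equal to [E]. Conversely, if [L] contains the generators, the columns of the
    cokernel of [L :&: E] are such functionals, hence zero. *)
Lemma normal_k_generated_generates k :
  normal_k_generated G E k <-> exists X : 'M_(k, _), generates rG X.
Proof.
split=> [/(normal_k_generatedP _ nsEG)[y [Ey geny]] | [X genX]].
  exists (\matrix_i ErV (y i))%R => w w0.
  have sEK : E \subset joint_kernel w.
    apply: (geny (joint_kernel_group w)) => [|i];
      first exact: joint_kernel_normal.
    apply/joint_kernelP; split=> // g Gg;
      rewrite (abelem_rV_J abelE ntE nEG) //.
    have /(congr1 (row i)) := w0 g Gg.
    by rewrite !row_mul rowK row0.
  apply/row_matrixP=> i; rewrite rowE row0.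
  have /joint_kernelP[_ /(_ 1 (group1 G))] :=
    subsetP sEK _ (mem_rVabelem abelE ntE (delta_mx 0%R i)).
  by rewrite conjg1 rVabelemK.
apply/(normal_k_generatedP _ nsEG); exists (fun i => rV_E (row i X)).
split=> [i | L nsLG Ly]; first exact: mem_rVabelem.
pose U := rowg_mx (ErV @* (L :&: E)).
have sUE : ErV @* (L :&: E) = rowg U by rewrite rowg_mxK.
suff U_full : (1%:M%R <= U)%MS.
  apply: subset_trans (subsetIl L E).
  rewrite -[L :&: E](abelem_rV_mK abelE ntE (subsetIr _ _)) sUE.
  by rewrite -{1}(im_rVabelem abelE ntE) -rowg1 rVabelemS rowgS.
rewrite sub1mx -cokermx_eq0; apply/eqP/matrixP=> i j.
suff /colP/(_ i) : col j (cokermx U) = 0%R by rewrite !mxE.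
apply: genX => g Gg; apply/row_matrixP=> l.
rewrite !row_mul row0.
suff /submxP[D ->] : ((row l X *m rG g)%R <= U)%MS.
  by rewrite colE mulmxA -(mulmxA D U) mulmx_coker mulmx0 mul0mx.
rewrite -mem_rowg -sUE -[row l X](rVabelemK abelE ntE)
  -(abelem_rV_J abelE ntE nEG) ?mem_rVabelem //.
have Eg : rV_E (row l X) ^ g \in E by rewrite memJ_norm ?mem_rVabelem
  ?(subsetP nEG).
apply: mem_morphim => //; rewrite inE Eg andbT.
by rewrite memJ_norm ?Ly // (subsetP (normal_norm nsLG)).
Qed.

(** Minimal normal subgroups of [G] inside [E] are simple submodules, and by [socle_sub_gen] their
    sum is everything. *)
Lemma socle_abelem_semisimple :
  E \subset socle_of G -> mxsemisimple rG 1%:M%R.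
Proof.
move=> sES.
pose P M := min_normal G M && (M \subset E).
pose U (M : {group gT}) := rowg_mx (ErV @* M).
have simU M : P M -> mxsimple rG (U M).
  case/andP=> minM sME; apply/mxsimple_abelemGP => //.
  exact: min_normal_minnormal.
have modW : mxmodule rG (\sum_(M | P M) U M)%MS.
  by apply: sumsmx_module => M /simU[].
pose L := rV_E @* rowg (\sum_(M | P M) U M)%MS.
have nLG : G \subset 'N(L) by rewrite -mxmodule_abelem.
have sEL : E \subset L.
  apply: (socle_sub_gen nsEG sES nLG) => M minM sME.
  rewrite /L -{1}(abelem_rV_mK abelE ntE sME) rVabelemS.
  apply: subset_trans (sub_rowg_mx _) _; rewrite rowgS.
  by apply: (sumsmx_sup M); rewrite ?/P ?minM.
apply: eqmx_semisimple (sumsmx_semisimple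
  (fun M PM => mxsimple_semisimple (simU M PM))).
apply/eqmxP; rewrite submx1 -rowgS rowg1 -(rVabelemS abelE ntE).
by rewrite im_rVabelem.
Qed.

Lemma normal_k_generated_joint_kernel k : E \subset socle_of G ->
  normal_k_generated G E k <->
    exists Y : 'M['F_p]_('dim E, k), joint_kernel Y \subset [1].
Proof.
move=> sES.
have ssE := mxsemisimple_repr (socle_abelem_semisimple sES).
split=> [/normal_k_generated_generates[X] | [Y /cogenerates_joint_kernel cogY]].
  case/(semisimple_cogenerates (r := Representation rG) ssE) => Y cogY.
  by exists Y; apply/cogenerates_joint_kernel.
by apply/normal_k_generated_generates;
  apply: (semisimple_generates (r := Representation rG) ssE cogY).
Qed.

End AbelemModule.

(** * Irreducible representations with a prescribed vector *)

Section IrreducibleVector.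

Local Open Scope ring_scope.

Variables (F : fieldType) (gT : finGroupType) (G : {group gT}).
Variables (J : finType) (R : pred J) (z : J -> gT) (C : J -> {set gT}).
Local Notation reprG := (mx_representation F G).

(** A nonzero [v] killed by the norm of [z j] is not fixed by [z j] when the order of [z j] is
    nonzero in [F]. Unlike not being fixed, this condition survives homomorphisms. *)
Definition fixed_and_killed n (rG : reprG n) (v : 'rV_n) :=
  forall j, R j -> {in C j, forall c, v *m rG c = v} /\
    v *m (\sum_(u in <[z j]>) rG u) = 0.

Hypothesis Gz : forall j, R j -> z j \in G.
Hypothesis GC : forall j, R j -> C j \subset G.

(** Equivariance is asked only along [v], because [in_submod] is equivariant only on vectors of the
    submodule. *)
Lemma fixed_and_killed_hom n m (r : reprG n) (s : reprG m) (v : 'rV_n) B :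
    {in G, forall g, v *m r g *m B = v *m B *m s g} ->
  fixed_and_killed r v -> fixed_and_killed s (v *m B).
Proof.
move=> homB fkv j Rj; have [fixv killv] := fkv j Rj; split.
  by move=> c Cc; rewrite -homB ?(subsetP (GC Rj)) // fixv.
rewrite mulmx_sumr -[RHS](mul0mx _ B) -killv mulmx_sumr mulmx_suml.
apply: eq_bigr => u zu; rewrite homB //.
by apply: subsetP zu; rewrite cycle_subG Gz.
Qed.

(* A representation of least degree with such a vector is irreducible. *)
Lemma fixed_and_killed_irr n (r : reprG n) (v : 'rV_n) :
    v != 0 -> fixed_and_killed r v ->
  exists m (s : reprG m) (w : 'rV_m),
    [/\ mx_irreducible s, w != 0 & fixed_and_killed s w].
Proof.
elim: n {-2}n (leqnn n) r v => [|d IHd] n le_n_d r v nzv fkv.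
  by move: le_n_d v nzv {fkv}; rewrite leqn0 => /eqP-> v; rewrite thinmx0 eqxx.
have nz1 : (1%:M : 'M[F]_n) != 0.
  by apply: contraNneq nzv => e1; rewrite -[v]mulmx1 e1 mulmx0.
case: (classic (mxnonsimple r 1%:M)) => [[U] | simr]; last first.
  by exists n, r, v; split=> //; apply/mxsimpleP; split; rewrite ?mxmodule1.
rewrite mxrank1 => /and4P[modU _ nzU ltU].
(* The vector stays nonzero in [U] if it lies there, and in the quotient by [U] otherwise. *)
case: (boolP (v <= U)%MS) => [Uv | notUv].
  apply: (IHd _ _ (submod_repr modU) (in_submod U v)).
  - by rewrite -ltnS (leq_trans ltU).
  - by rewrite -(inj_eq val_submod_inj) in_submodK // linear0.
  rewrite in_submodE; apply: fixed_and_killed_hom fkv => g Gg.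
  by rewrite -!in_submodE in_submodJ.
apply: (IHd _ _ (factmod_repr modU) (in_factmod U v)).
- rewrite mxrank_coker -ltnS (leq_trans _ le_n_d) //.
  by rewrite ltn_subrL lt0n mxrank_eq0 nzU (leq_ltn_trans (leq0n _) ltU).
- by rewrite in_factmod_eq0.
rewrite in_factmodE; apply: fixed_and_killed_hom fkv => g Gg.
by rewrite -!in_factmodE -in_factmodJ.
Qed.

Variable Q : J -> {group gT}.
Hypothesis CQ : forall i j, R i -> R j -> C i \subset Q j.
Hypothesis Cz : forall i j, R i -> R j -> z j \in 'C(C i).
Hypothesis zz : forall i j, R i -> R j -> commute (z i) (z j).
Hypothesis zQ : forall i j, R i -> R j -> i != j -> z i \in Q j.
Hypothesis zNQ : forall j, R j -> z j \notin Q j.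

Local Notation aG := (regular_repr F G).

(* The tensor product of the differences of indicators of Q j and Q j * z j. *)
Definition coset_diff (x : gT) : F :=
  \prod_(j | R j) ((x \in Q j)%:R - ((x * (z j)^-1)%g \in Q j)%:R).

Definition coset_diff_mx := \sum_(x in G) coset_diff x *: aG x.

Lemma coset_diff_mx_act g : g \in G ->
  coset_diff_mx *m aG g = \sum_(x in G) coset_diff (x * g^-1)%g *: aG x.
Proof.
move=> Gg; rewrite /coset_diff_mx mulmx_suml [RHS](reindex_acts 'R _ Gg)
  ?astabsR //=.
by apply: eq_bigr => x Gx; rewrite mulgK -scalemxAl repr_mxM.
Qed.

(** Translation by [c] in [C j] preserves each factor, as [c] lies in every [Q i] and commutes with
    every [z i]. Along [<[z j]>] the factors other than the [j]-th are constant for the same reason,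
    while the sum of the [j]-th telescopes to 0. *)
Lemma regular_fixed_and_killed : fixed_and_killed aG (gring_row coset_diff_mx).
Proof.
move=> j Rj; split=> [c Cc | ].
  have Gc := subsetP (GC Rj) c Cc.
  rewrite -gring_row_mul coset_diff_mx_act //; congr gring_row.
  apply: eq_bigr => x _; congr (_ *: _); apply: eq_bigr => i Ri.
  have Qc : c^-1%g \in Q i by rewrite groupV (subsetP (CQ Rj Ri)).
  have cz : commute c^-1%g (z i)^-1%g.
    by apply/commuteV/commute_sym/commuteV/(centP (Cz Rj Ri)).
  by rewrite -mulgA cz mulgA !(groupMr _ Qc).
rewrite -gring_row_mul mulmx_sumr.
rewrite (eq_bigr (fun u => \sum_(x in G) coset_diff (x * u^-1)%g *: aG x));
  last first.
  move=> u zu; apply: coset_diff_mx_act; apply: subsetP zu.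
  by rewrite cycle_subG Gz.
rewrite exchange_big big1 ?linear0 //= => x Gx.
rewrite -scaler_suml (_ : \sum_(u in _) _ = 0) ?scale0r //.
pose P := \prod_(i | R i && (i != j))
  ((x \in Q i)%:R - ((x * (z i)^-1)%g \in Q i)%:R) : F.
pose a (u : gT) : F := ((x * u^-1)%g \in Q j)%:R.
rewrite (eq_bigr (fun u => (a u - a (z j * u)%g) * P)) => [|u zu].
  rewrite -mulr_suml sumrB [X in _ - X](_ : _ = \sum_(u in <[z j]>) a u).
    by rewrite subrr mul0r.
  rewrite [RHS](reindex_inj (mulgI (z j))); apply: eq_bigl => u.
  by rewrite groupMl ?cycle_id.
rewrite /coset_diff (bigD1 j) //=; congr (_ * _).
  by rewrite /a invMg mulgA.
apply: eq_bigr => i /andP[Ri neq_ij].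
have Qu : u^-1%g \in Q i.
  by rewrite groupV; apply: subsetP zu; rewrite cycle_subG zQ // eq_sym.
have cz : commute u^-1%g (z i)^-1%g.
  apply/commuteV/commute_sym/commuteV; case/cycleP: zu => l ->.
  exact/commuteX/zz.
by rewrite -mulgA cz mulgA !(groupMr _ Qu).
Qed.

(** The coefficient at 1 is 1, because each [Q j] contains 1 but not the inverse of [z j]. *)
Lemma coset_diff_neq0 : gring_row coset_diff_mx != 0.
Proof.
apply/eqP => A0; have: gring_proj 1%g coset_diff_mx = 0.
  by rewrite /gring_proj /= A0 trmx0 row0.
rewrite linear_sum (bigD1 1%g) //= linearZ /= gring_projE // eqxx big1;
  last first.
  by move=> x /andP[Gx /negPf neq_x1];
    rewrite linearZ /= gring_projE // eq_sym neq_x1 scaler0.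
rewrite addr0 /coset_diff big1 => [|j Rj]; last first.
  by rewrite group1 mul1g groupV (negPf (zNQ Rj)) subr0.
by rewrite scale1r => /matrixP/(_ 0 0)/eqP; rewrite !mxE oner_eq0.
Qed.

Lemma irr_fixed_and_killed : exists m (s : reprG m) (w : 'rV_m),
  [/\ mx_irreducible s, w != 0 & fixed_and_killed s w].
Proof. exact: fixed_and_killed_irr coset_diff_neq0 regular_fixed_and_killed.
  Qed.

End IrreducibleVector.

(** * Direct sums of irreducible representations *)

Section DirectSum.

Local Open Scope ring_scope.

Variables (F : fieldType) (gT : finGroupType) (G : {group gT}).
Local Notation reprG := (mx_representation F G).

Lemma mxsimple_embed m n (r : reprG m) (s : reprG n) (B : 'M_(m, n)) U :
    row_free B -> {in G, forall g, r g *m B = B *m s g} ->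
  mxsimple r U -> mxsimple s <<U *m B>>%MS.
Proof.
move=> freeB homB [modU nzU minU]; split.
- rewrite (eqmx_module _ (genmxE _)); apply/mxmoduleP=> g Gg.
  by rewrite -mulmxA -homB // mulmxA submxMr // (mxmoduleP modU).
- by rewrite -mxrank_eq0 genmxE mxrankMfree ?mxrank_eq0.
move=> V modV; rewrite genmxE => sVU nzV.
have sVB : (V <= B)%MS := submx_trans sVU (submxMl _ _).
pose V' := V *m pinvmx B; have defV : V' *m B = V by rewrite mulmxKpV.
rewrite genmxE -defV submxMfree // -(genmxE V') minU //.
- rewrite (eqmx_module _ (genmxE _)); apply/mxmoduleP=> g Gg.
  by rewrite -(submxMfree _ _ freeB) -mulmxA homB // mulmxA defV
    (mxmoduleP modV).
- by rewrite genmxE -(submxMfree _ _ freeB) defV.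
by rewrite -mxrank_eq0 genmxE -(mxrankMfree _ freeB) defV mxrank_eq0.
Qed.

Lemma semisimple_constituents_dsum k (s : 'I_k -> representation F G) :
    (forall i, mx_irreducible (s i)) ->
  exists n (rG : reprG n), semisimple_constituents rG k /\
    forall i, rker rG \subset rker (s i).
Proof.
elim: k s => [|k IHk] s irr_s.
  exists 0%N, (@grepr0 F gT G); split=> [|[]//]; exists (fun _ => 0).
  split=> [[]//||]; first by rewrite big_ord0 [1%:M]flatmx0.
  by rewrite mxdirectE /= !big_ord0 mxrank0.
have [n [r2 [[U [simU defU dxU]] ker2]]] :=
  IHk _ (fun i => irr_s (lift ord0 i)).
pose m := rdegree (s ord0).
pose rG : reprG (m + n) := dadd_grepr (s ord0) (Representation r2).
pose B1 : 'M[F]_(m, m + n) := row_mx 1%:M 0.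
pose B2 : 'M[F]_(n, m + n) := row_mx 0 1%:M.
have homB1 : {in G, forall g, s ord0 g *m B1 = B1 *m rG g}.
  by move=> g _; rewrite mul_mx_row mul_row_block !mul1mx !mul0mx !mulmx0
    mulmx1 !addr0.
have homB2 : {in G, forall g, r2 g *m B2 = B2 *m rG g}.
  by move=> g _; rewrite mul_mx_row mul_row_block !mul1mx !mul0mx !mulmx0
    mulmx1 !add0r.
have freeB1 : row_free B1.
  by apply/row_freeP; exists (col_mx 1%:M 0);
    rewrite mul_row_col mul1mx mul0mx addr0.
have freeB2 : row_free B2.
  by apply/row_freeP; exists (col_mx 0 1%:M);
    rewrite mul_row_col mul1mx mul0mx add0r.
exists (m + n)%N, rG; split; last first.
  move=> i; apply/subsetP=> x /rkerP[Gx]; rewrite /= scalar_mx_block.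
  case/eq_block_mx=> s0x _ _ r2x; case: (unliftP ord0 i) => [j|] ->.
    by apply: (subsetP (ker2 j)); apply/rkerP.
  by apply/rkerP.
pose U' (i : 'I_k.+1) : 'M[F]_(m + n) :=
  if unlift ord0 i is Some j then <<U j *m B2>>%MS else <<1%:M *m B1>>%MS.
have full : (1%:M <= \sum_i U' i)%MS.
  rewrite scalar_mx_block block_mxEv -addsmxE addsmx_sub; apply/andP; split.
    by apply: (sumsmx_sup ord0) => //; rewrite /U' unlift_none genmxE mul1mx.
  have -> : row_mx 0 1%:M = 1%:M *m B2 by rewrite mul1mx.
  apply: submx_trans (submxMr B2 (_ : 1%:M <= \sum_i U i)%MS) _;
    first by rewrite defU.
  rewrite sumsmxMr_gen; apply/sumsmx_subP=> j _.
  by apply: (sumsmx_sup (lift ord0 j)) => //; rewrite /U' liftK.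
exists U'; split.
- move=> i; rewrite /U'; case: (unlift ord0 i) => [j|].
    exact: mxsimple_embed (simU j).
  exact: mxsimple_embed (irr_s ord0).
- by apply/eqmxP; rewrite submx1.
(* Directness is a rank count: the sum has rank [m + n], and the ranks of the summands add up to at
   most that. *)
rewrite mxdirectE /= eqn_leq mxrank_sum_leqif /=.
have := mxrankS full; rewrite mxrank1; apply: leq_trans.
rewrite big_ord_recl /U' unlift_none genmxE mul1mx (eqP freeB1) leq_add2l.
rewrite (eq_bigr (fun i => \rank (U i))) => [|i _].
  move: dxU; rewrite mxdirectE /= => /eqP <-; exact: rank_leq_row.
by rewrite liftK genmxE mxrankMfree.
Qed.

End DirectSum.

(** * Functionals and their kernels *)

Section KernelFamilies.

Local Open Scope abelem_scope.

Variables (gT : finGroupType) (G E : {group gT}).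

(* For E elementary abelian the second clause says that C i has index 1 or p, *)
(* so C is a family of kernels of functionals on E. *)
Definition kernel_family k (C : 'I_k -> {group gT}) :=
  [/\ forall i, C i \subset E,
      forall i b, b \in E -> b \notin C i -> E \subset C i * <[b]>
    & forall M : {group gT}, M <| G -> M \subset E ->
      (forall i, M \subset C i) ->
        M \subset [1]].

Hypothesis nsEG : E <| G.
Let nEG := normal_norm nsEG.

Section Functional.

Variables (p : nat) (abelE : p.-abelem E) (ntE : E :!=: 1).
Local Notation ErV := (abelem_rV abelE ntE).

(** The columns of [K] are functionals with common kernel [C]. One of them is nonzero at [b], and
    its kernel is already inside [C] because [E] is covered by [C * <[b]>]. *)
Lemma functional_of_kernel (C : {group gT}) :
    C \subset E -> (forall b, b \in E -> b \notin C -> E \subset C * <[b]>) ->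
  exists y : 'cV['F_p]_('dim E),
    forall x, x \in E -> (ErV x *m y = 0)%R -> x \in C.
Proof.
move=> sCE cycC; have [sEC | /subsetPn[b Eb nCb]] := boolP (E \subset C).
  by exists 0%R => x Ex _; apply: subsetP Ex.
pose K := cokermx (rowg_mx (ErV @* C)).
have memC x : x \in E -> (ErV x *m K == 0)%R -> x \in C.
  move=> Ex; rewrite -submxE -mem_rowg rowg_mxK => /morphimP[c Ec Cc].
  by move/(abelem_rV_inj Ex Ec)->.
have CK c : c \in C -> (ErV c *m K = 0)%R.
  move=> Cc; apply/eqP; rewrite -submxE -mem_rowg rowg_mxK mem_morphim //.
  exact: subsetP Cc.
have nz_bK : (ErV b *m K != 0)%R by apply: contra nCb; apply: memC.
have [j nz_bj] : exists j, ((ErV b *m K) 0 j != 0)%R.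
  apply/existsP; rewrite -negb_forall; apply: contra nz_bK => /forallP bK0.
  by apply/eqP/rowP=> j; rewrite (eqP (bK0 j)) mxE.
exists (col j K) => x Ex xj0.
have /mulsgP[c _ Cc /cycleP[m ->] def_x] := subsetP (cycC b Eb nCb) x Ex.
have Ec := subsetP sCE c Cc.
have Exb : ErV x = (ErV c + m%:R *: ErV b)%R.
  by rewrite def_x abelem_rV_M ?groupX // abelem_rV_X.
suff m0 : (m%:R = 0 :> 'F_p)%R.
  by apply: memC; rewrite // Exb m0 scale0r addr0 CK.
move: xj0; rewrite colE mulmxA -colE Exb mulmxDl -scalemxAl CK // add0r.
move/matrixP/(_ 0%R 0%R)/eqP; rewrite !mxE mulf_eq0 => /orP[/eqP // | bj0].
by rewrite mxE bj0 in nz_bj.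
Qed.

Lemma kernel_of_functional (y : 'cV['F_p]_('dim E)) :
  prime p -> exists C : {group gT},
  [/\ C \subset E, forall b, b \in E -> b \notin C -> E \subset C * <[b]>
    & forall x, x \in E -> (x \in C) = (ErV x *m y == 0)%R].
Proof.
move=> pr_p; pose f x := (ErV x *m y)%R 0%R 0%R.
have f0 x : (ErV x *m y == 0)%R = (f x == 0)%R.
  apply/eqP/eqP=> [xy0 | fx0]; first by rewrite /f xy0 mxE.
  by apply/matrixP=> i j; rewrite !ord1 [RHS]mxE.
have fM x z : x \in E -> z \in E -> (f (x * z)%g = f x + f z)%R.
  by move=> Ex Ez; rewrite /f abelem_rV_M // mulmxDl mxE.
have fX x m : x \in E -> (f (x ^+ m)%g = m%:R * f x)%R.
  by move=> Ex; rewrite /f abelem_rV_X // -scalemxAl mxE.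
have Cgr : group_set [set x in E | f x == 0%R].
  apply/group_setP; split=> [|x z]; rewrite !inE.
    by rewrite group1 -f0 abelem_rV_1 mul0mx eqxx.
  case/andP=> Ex /eqP fx0 /andP[Ez /eqP fz0].
  by rewrite groupM // fM // fx0 fz0 addr0 eqxx.
exists (Group Cgr); split=> [||x Ex] /=; last by rewrite inE Ex f0.
  by apply/subsetP=> x; rewrite inE => /andP[].
move=> b Eb; rewrite inE Eb /= => nz_fb; apply/subsetP=> x Ex.
(* This exponent puts [x * (b ^+ m)^-1] in the kernel of [f]. *)
pose m := (f x / f b)%R : 'F_p.
have fm : f (b ^+ m) = f x.
  by rewrite fX // natr_Zp divfK.
rewrite -(mulgKV (b ^+ m) x); apply: mem_mulg; last exact: mem_cycle.
have Ebm : b ^+ m \in E by rewrite groupX.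
rewrite inE groupM ?groupV //=; apply/eqP/(addIr (f (b ^+ m))).
by rewrite -fM ?groupM ?groupV // mulgKV add0r.
Qed.

End Functional.

Lemma normal_k_generated_kernel_family p k : prime p -> p.-abelem E ->
  E \subset socle_of G ->
  normal_k_generated G E k <-> exists C : 'I_k -> {group gT}, kernel_family C.
Proof.
(* The trivial group is treated apart because [abelem_rV] requires a nontrivial one. *)
move=> pr_p abelE sES; have [E1 | ntE] := eqVneq (gval E) 1.
  split=> _.
    exists (fun _ => E); split=> // [i b Eb | M _]; first by rewrite Eb.
    by rewrite E1.
  apply/(normal_k_generatedP _ nsEG); exists (fun _ => 1).
  by split=> // L _ _; rewrite E1 sub1G.
have Ycol (Y : 'M['F_p]_('dim E, k)) x : x \in joint_kernel G abelE ntE Y ->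
    forall i, (abelem_rV abelE ntE x *m col i Y = 0)%R.
  case/joint_kernelP=> Ex /(_ 1 (group1 G)); rewrite conjg1 => xY i.
  by rewrite colE mulmxA xY mul0mx.
split=> [/(normal_k_generated_joint_kernel nsEG abelE ntE k sES)[Y trivY] |
  [C [sCE cycC coreC]]].
  have [C CP] := fin_all_exists
    (fun i => kernel_of_functional abelE ntE (col i Y) pr_p).
  exists C; split=> [i|i|M nsMG sME sMC];
    [by case: (CP i) | by case: (CP i) | ].
  apply: subset_trans trivY; apply/subsetP=> x Mx.
  apply/joint_kernelP; split=> [|g Gg]; first exact: subsetP Mx.
  have Mxg : x ^ g \in M by rewrite memJ_norm // (subsetP (normal_norm nsMG)).
  apply: col_inj => i; rewrite colE -mulmxA -colE.
  have [_ _ CiP] := CP i; move: (subsetP (sMC i) _ Mxg).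
  rewrite CiP ?(subsetP sME) // => /eqP->.
  by apply/matrixP=> a b; rewrite !mxE.
have [y yP] := fin_all_exists (fun i =>
  functional_of_kernel abelE ntE (sCE i) (cycC i)).
apply/(normal_k_generated_joint_kernel nsEG abelE ntE k sES).
pose Y := (\matrix_(a, i) y i a 0)%R : 'M['F_p]_('dim E, k).
have colY i : col i Y = y i by apply/matrixP=> a b; rewrite !mxE ord1.
exists Y; apply: (coreC (joint_kernel_group nsEG abelE ntE Y)) => [||i].
- exact: joint_kernel_normal.
- by apply/subsetP=> x /joint_kernelP[].
apply/subsetP=> x Kx; have /joint_kernelP[Ex _] := Kx.
by apply: yP; rewrite // -colY Ycol.
Qed.

End KernelFamilies.

(** * Faithful completely reducible representations *)

Section KernelsOfConstituents.

Variables (F : fieldType) (gT : finGroupType) (G E : {group gT}) (p : nat).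
Hypotheses (nsEG : E <| G) (pr_p : prime p) (abelE : p.-abelem E).
Variables (n : nat) (rG : mx_representation F G n).

Lemma constituent_kernel U : mxsimple rG U -> exists C : {group gT},
  [/\ C \subset E, forall b, b \in E -> b \notin C -> E \subset C * <[b]>
    & forall M : {group gT}, M <| G -> M \subset C -> M \subset rstab rG U].
Proof.
case=> modU nzU simU; have sEG := normal_sub nsEG.
pose rE := subg_repr rG sEG.
have modUE : mxmodule rE U by apply: mxmodule_subg.
have [W simW sWU] := classically_Prop (mxsimple_exists modUE nzU).
have [modW nzW _] := simW.
pose C := rstab_group rE W.
have sCE : C \subset E by apply: rstab_sub.
have abE := abelem_abelian abelE.
have nCE : E \subset 'N(C) by rewrite sub_abelian_norm.
have cycEC : cyclic (E / C).
  have := center_kquo_cyclic ((submod_mx_irr modW).2 simW).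
  rewrite (center_idP _) ?quotient_abelian //.
  suff -> : rker (submod_repr modW) = C by [].
  exact: rker_submod.
exists C; split=> // [b Eb nCb | M nsMG sMC].
  have NCb : b \in 'N(C) by apply: subsetP Eb.
  have abelQ : p.-abelem (E / C) := quotient_abelem C abelE.
  have Qb : coset C b \in E / C by apply: mem_quotient.
  have ntb : coset C b != 1.
    by apply: contra nCb => /eqP; apply: coset_idr.
  have sEb : E / C \subset <[b]> / C.
    rewrite quotient_cycle // -(_ : <[coset C b]> = E / C) //.
    apply/eqP; rewrite eqEcard cycle_subG Qb /= -orderE (abelem_order_p
      abelQ) //.
    case/cyclicP: cycEC => x defx; rewrite defx -orderE dvdn_leq ?prime_gt0 //.
    by rewrite -(cycle_abelem (x := x)) ?pr_p ?orbT // -defx.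
  rewrite -quotientSK ?(subset_trans sEb) //.
have sMG := normal_sub nsMG.
have modI : mxmodule rG (U :&: rfix_mx rG M)%MS.
  by rewrite capmx_module ?normal_rfix_mx_module.
have fixW : (W <= rfix_mx rG M)%MS.
  apply/rfix_mxP=> x Mx; have := subsetP sMC x Mx.
  by rewrite inE => /andP[_ /eqP].
rewrite rfix_mx_rstabC //; apply: submx_trans (capmxSr U _).
apply: simU => //; first exact: capmxSl.
by apply: contraNneq nzW => I0; rewrite -submx0 -I0 sub_capmx sWU.
Qed.

Lemma constituents_kernel_family (N : {group gT}) (sNG : N \subset G) k :
    E \subset N -> semisimple_constituents rG k ->
    mx_faithful (subg_repr rG sNG) ->
  exists C : 'I_k -> {group gT}, kernel_family G E C.
Proof.
move=> sEN [U [simU defU _]] faithN.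
have [C CP] := fin_all_exists (fun i => constituent_kernel (simU i)).
exists C; split=> [i|i|M nsMG sME sMC]; [by case: (CP i) | by case: (CP i) | ].
apply: subset_trans faithN; rewrite rker_subg subsetI (subset_trans sME) //=.
have sMG := normal_sub nsMG.
rewrite rfix_mx_rstabC // -defU; apply/sumsmx_subP=> i _.
by rewrite -rfix_mx_rstabC //; have [_ _] := CP i; apply.
Qed.

End KernelsOfConstituents.

(** * Construction of the faithful representation *)

Section FaithfulRepresentation.

Variables (F : fieldType) (gT : finGroupType) (G N : {group gT}).
Hypothesis nsNG : N <| G.
Let A := abelian_socle_group G.
Hypothesis charF : ([pchar F]%R^').-group (A :&: N).

Definition socle_prime (p : nat) := prime p && (p %| #|A|)%N.

(** If only the characteristic divided the order, [M] would be solvable, hence abelian by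
    minimality. Otherwise Cauchy's theorem applies to another prime. *)
Lemma nonabelian_pchar'_elt (M : {group gT}) :
    min_normal G M -> ~~ abelian M ->
  exists x, [&& x \in M, x != 1 & (#[x]%:R != 0 :> F)%R].
Proof.
move=> minM nabM.
have [ntM _ _] := min_normalP minM.
have [pM | ] := boolP ([pchar F]%R.-group M).
  case/negP: nabM; have pr_q : prime (pdiv #|M|).
    by rewrite pdiv_prime // ltn_neqAle eq_sym -trivg_card1 ntM cardG_gt0.
  have charq : pdiv #|M| \in [pchar F]%R by apply: (pgroupP pM) (pdiv_dvd _).
  have qM : (pdiv #|M|).-group M by rewrite -(eq_pgroup _ (pcharf_eq charq)).
  have solM : solvable M := pgroup_sol qM.
  have [_ _ /is_abelemP[r _ abelM]] :=
    minnormal_solvable (min_normal_minnormal minM) (subxx M) solM.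
  exact: abelem_abelian abelM.
rewrite /pgroup /pnat cardG_gt0 => /allPn[q].
rewrite mem_primes => /and3P[pr_q _ q_dv] charq.
have [x Mx ox] := Cauchy pr_q q_dv; exists x;
  rewrite Mx -order_gt1 ox prime_gt1 //=.
by rewrite -pcharf'_nat pnatE.
Qed.

(* The subgroups Q j of irr_fixed_and_killed are C p * 'O_p^'(A) * K, with K *)
(* a complement of A in the socle, and 'C(M). *)
Lemma irr_over_kernels (C : 'I_(#|A|.+1) -> {group gT}) :
    (forall p : 'I_(#|A|.+1), socle_prime p -> C p \subset 'O_p(A) :&: N) ->
    (forall p : 'I_(#|A|.+1), socle_prime p -> forall b, b \in 'O_p(A) :&: N ->
       b \notin C p -> 'O_p(A) :&: N \subset C p * <[b]>) ->
  exists s : representation F G, [/\ mx_irreducible s,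
    forall p : 'I_(#|A|.+1), socle_prime p -> forall M : {group gT},
      M \subset 'O_p(A) :&: N -> M \subset rker s -> M \subset C p
    & forall M : {group gT}, min_normal G M -> ~~ abelian M ->
      ~~ (M \subset rker s)].
Proof.
move=> sCE cycC.
have sAG : A \subset G := normal_sub (abelian_socle_normal G).
have abA : abelian A := abelian_socle_abelian G.
have sEA (p : 'I_(#|A|.+1)) : 'O_p(A) :&: N \subset A.
  by rewrite (subset_trans (subsetIl _ _)) ?pcore_sub.
have cMA M : min_normal G M -> A \subset 'C(M) by apply: abelian_socle_cent.
have [K [nsKG tiAK defS]] := socle_compl (abelian_socle_normal G)
  (abelian_socle_sub G).
(* If [M] met [K] trivially, [K] and [A] would both centralise [M]; then so would the socle, which
   contains [M]. *)
have nonabK M : min_normal G M -> ~~ abelian M -> M \subset K.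
  move=> minM nabM; apply: (min_normal_sub minM (normal_norm nsKG)).
  apply: contra nabM => /eqP tiMK; have [_ nsMG _] := min_normalP minM.
  have cMK : K \subset 'C(M).
    have nMK := subset_trans (normal_sub nsKG) (normal_norm nsMG).
    have nKM := subset_trans (normal_sub nsMG) (normal_norm nsKG).
    by apply/commG1P/trivgP; rewrite -tiMK subsetI commg_subl commg_subr nMK.
  apply: subset_trans (min_normal_socle minM) (subset_trans defS _).
  by rewrite mul_subG ?cMA.
pose J := ('I_(#|A|.+1) + {group gT})%type.
(* Primes at which [C p] is already everything impose no condition and are left out, so under [R]
   the default 1 in [z] is never taken. *)
pose R (j : J) := match j with
  | inl p => socle_prime p && ~~ ('O_p(A) :&: N \subset C p)
  | inr M => min_normal G M && ~~ abelian M end.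
pose z (j : J) := odflt 1 match j with
  | inl p => [pick x in 'O_p(A) :&: N | x \notin C p]
  | inr M => [pick x | [&& x \in M, x != 1 & (#[x]%:R != 0 :> F)%R]] end.
pose Q (j : J) := match j with
  | inl p => ((C p <*> 'O_(p^')(A)) <*> K)%G
  | inr M => 'C(M)%G end.
pose Cs (j : J) : {set gT} := match j with inl p => C p | inr M => [1] end.
have zE p : R (inl p) -> z (inl p) \in 'O_p(A) :&: N /\ z (inl p) \notin C p.
  case/andP=> _ /subsetPn[x Ex nCx]; rewrite /z.
  by case: pickP => [y /andP[] | /(_ x)] //=; rewrite Ex nCx.
have zM M : R (inr M) ->
    [&& z (inr M) \in M, z (inr M) != 1 & (#[z (inr M)]%:R != 0 :> F)%R].
  case/andP=> minM nabM; rewrite /z;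
    have [x xP] := nonabelian_pchar'_elt minM nabM.
  by case: pickP => [y //| /(_ x)]; rewrite xP.
have zA p : R (inl p) -> z (inl p) \in A.
  by case/zE => Ez _; apply: subsetP Ez.
have CA p : R (inl p) -> C p \subset A.
  by case/andP=> pP _; apply: subset_trans (sCE p pP) _.
have zMM M : R (inr M) -> z (inr M) \in M by case/zM/and3P.
have Gz j : R j -> z j \in G.
  case: j => [p /zA/(subsetP sAG) // | M RM].
  have /andP[/min_normalP[_ nsMG _] _] := RM.
  exact: subsetP (normal_sub nsMG) _ (zMM M RM).
have GC j : R j -> Cs j \subset G.
  case: j => [p /CA sCA | M _]; last by rewrite sub1G.
  exact: subset_trans sCA sAG.
have zCM j M : R j -> R (inr M) -> j != inr M -> z j \in 'C(M).
  move=> Rj RM neqj; have /andP[minM _] := RM;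
    case: j Rj neqj => [p Rp _ | M' RM' neqM].
    exact: subsetP (cMA M minM) _ (zA p Rp).
  have /andP[minM' _] := RM'; apply: subsetP (zMM M' RM').
  by apply: (nonabelian_min_normal_cent minM minM'); rewrite eq_sym;
    apply: contra neqM => /eqP->.
have CQ i j : R i -> R j -> Cs i \subset Q j.
  case: i => [p | M] Ri Rj; last exact: sub1G.
  case: j Rj => [q | M] Rj; last first.
    by have /andP[minM _] := Rj; apply: subset_trans (CA p Ri) (cMA M minM).
  apply: subset_trans (joing_subl _ _); have [-> | neq_pq] := eqVneq p q.
    exact: joing_subl.
  apply: subset_trans (joing_subr _ _); have /andP[pP _] := Ri.
  apply: subset_trans (sCE p pP) (subset_trans (subsetIl _ _) _).
  apply: sub_pcore => r; rewrite !inE => /eqP->; exact: neq_pq.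
have Cz i j : R i -> R j -> z j \in 'C(Cs i).
  case: i => [p | M] Ri Rj; last by rewrite /= cent1T inE.
  case: j Rj => [q | M] Rj; last first.
    have /andP[minM _] := Rj; apply: subsetP (zMM M Rj).
    by rewrite centsC (subset_trans (CA p Ri)) ?cMA.
  by apply: subsetP (zA q Rj); apply: subset_trans abA (centS (CA p Ri)).
have zz i j : R i -> R j -> commute (z i) (z j).
  move=> Ri Rj; have [-> // | neq_ij] := eqVneq i j.
  case: j => [q | M] in Rj neq_ij *; last first.
    exact: (centP (zCM i M Ri Rj neq_ij)) (zMM M Rj).
  case: i => [p | M] in Ri neq_ij *.
    exact: (centsP abA) (zA p Ri) _ (zA q Rj).
  apply/commute_sym; rewrite eq_sym in neq_ij.
  exact: (centP (zCM _ M Rj Ri neq_ij)) (zMM M Ri).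
have zQ i j : R i -> R j -> i != j -> z i \in Q j.
  move=> Ri Rj neq_ij; case: j => [q | M] in Rj neq_ij *; last exact: zCM.
  case: i => [p | M] in Ri neq_ij *.
    apply: (subsetP (joing_subl _ _)); apply: (subsetP (joing_subr _ _)).
    have [/setIP[Op _] _] := zE p Ri; apply: subsetP Op.
    apply: sub_pcore => r; rewrite !inE => /eqP->.
    by apply: contra neq_ij => /eqP/val_inj->.
  apply: (subsetP (joing_subr _ _)); have /andP[minM nabM] := Ri.
  exact: subsetP (nonabK M minM nabM) _ (zMM M Ri).
have zNQ j : R j -> z j \notin Q j.
  case: j => [p | M] Rj; last first.
    have /and3P[Mz ntz _] := zM M Rj; have /andP[minM nabM] := Rj.
    apply: contra nabM => Cz1; rewrite /abelian.
    apply: (min_normal_sub minM).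
      by rewrite norms_cent // normal_norm //; case/min_normalP: minM.
    by apply: contraNneq ntz => Z1; rewrite -in_set1 -set1gE -Z1 inE Mz.
  (* Decompose [z (inl p)] along the three factors of [Q]: the part in [K] is trivial since [A]
     meets [K] trivially, the [p']-part since the rest is a [p]-element, and what remains lies in
     [C p]. *)
  have [Ez nCz] := zE p Rj; apply: contra nCz.
  have sOA : 'O_(p^')(A) \subset A := pcore_sub _ _.
  have sCA := CA p Rj.
  have sCOA : C p <*> 'O_(p^')(A) \subset A by rewrite join_subG sCA.
  have nKA : A \subset 'N(K) := subset_trans sAG (normal_norm nsKG).
  rewrite /= norm_joinEl ?(subset_trans sCOA) // => /mulsgP[y t COy Kt def_z].
  have t1 : t = 1.
    apply/set1gP; rewrite -tiAK inE Kt andbT -(mulKg y t) -def_z.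
    exact: groupM (groupVr (subsetP sCOA y COy)) (zA p Rj).
  move: def_z; rewrite t1 mulg1 => def_z; rewrite -def_z in COy.
  have cOC : 'O_(p^')(A) \subset 'C(C p).
    by rewrite (subset_trans sOA) // (subset_trans abA) ?centS.
  move: COy; rewrite /= cent_joinEr // => /mulsgP[c d Cc Od def_zcd].
  suff d1 : d = 1 by rewrite def_zcd d1 mulg1.
  have tiO : 'O_p(A) :&: 'O_(p^')(A) = 1.
    by apply: coprime_TIg; apply: pnat_coprime (pcore_pgroup _ _)
      (pcore_pgroup _ _).
  have /andP[pP _] := Rj; have /setIP[Oz _] := Ez.
  have /setIP[Oc _] := subsetP (sCE p pP) c Cc.
  by apply/set1gP; rewrite -tiO inE Od andbT -(mulKg c d) -def_zcd groupM
    ?groupV.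
have [m [s [w [irr_s nzw fkw]]]] :=
  irr_fixed_and_killed F Gz GC CQ Cz zz zQ zNQ.
(* Were [w] fixed, the norm of [z j] would multiply it by the order of [z j] instead of killing
   it. *)
have not_fixed j : R j -> (#[z j]%:R != 0 :> F)%R -> (w *m s (z j) != w)%R.
  move=> Rj nz_oz; apply: contra nzw => /eqP fixw; have [_ killw] := fkw j Rj.
  have Gzj := Gz j Rj.
  have fixX l : (w *m s (z j ^+ l)%g = w)%R.
    elim: l => [|l IHl]; first by rewrite expg0 repr_mx1 mulmx1.
    by rewrite expgSr repr_mxM ?groupX // mulmxA IHl.
  have : (#[z j]%:R *: w == 0)%R.
    rewrite -killw mulmx_sumr (eq_bigr (fun _ => w)) => [|u /cycleP[l ->]] //.
    by rewrite sumr_const scaler_nat eqxx.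
  by rewrite scaler_eq0 (negPf nz_oz).
exists (Representation s); split=> //= [p pP M sME sMs | M minM nabM].
  (* With [b] in [M] outside [C p], the element [z (inl p)] lies in [C p * <[b]>]. The first factor
     fixes [w] by the choice of [w] and the second lies in [rker s], so [z (inl p)] would fix
     [w]. *)
  apply/subsetP=> b Mb; apply: contraT => nCb.
  have Eb := subsetP sME b Mb.
  have Rp : R (inl p) by rewrite /= pP; apply/subsetPn; exists b.
  have [Ez nCz] := zE p Rp; have sEC := cycC p pP b Eb nCb.
  have /negP[] : (w *m s (z (inl p)) != w)%R.
    apply: not_fixed => //; rewrite -pcharf'_nat.
    have sEB : 'O_p(A) :&: N \subset A :&: N by rewrite setSI ?pcore_sub.
    exact: mem_p_elt charF (subsetP sEB _ Ez).
  have [fixC _] := fkw (inl p) Rp.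
  case/mulsgP: (subsetP sEC _ Ez) => c d Cc bd ->.
  have /rkerP[Gd sd1] : d \in rker s.
    by apply: subsetP sMs _ (subsetP _ _ bd); rewrite cycle_subG.
  have Gc : c \in G := subsetP (GC (inl p) Rp) c Cc.
  by rewrite repr_mxM // sd1 mulmx1 fixC.
have RM : R (inr M) by rewrite /= minM.
have /and3P[Mz _ nz_oz] := zM M RM.
apply: contra (not_fixed (inr M) RM nz_oz) => sMs.
by have /rkerP[_ ->] := subsetP sMs _ Mz; rewrite mulmx1.
Qed.

(** The [i]-th summand is built from the [i]-th kernels at all primes. A minimal normal subgroup of
    [G] in the kernel on [N] is excluded by any one summand if nonabelian, which is where [k] must
    be positive, and by the core condition at its prime if abelian. *)
Lemma faithful_of_kernel_families k : (0 < k)%N ->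
    (forall p, socle_prime p -> exists C : 'I_k -> {group gT},
       kernel_family G ('O_p(A) :&: N)%G C) ->
  exists n (rG : mx_representation F G n), semisimple_constituents rG k
    /\ mx_faithful (subg_repr rG (normal_sub nsNG)).
Proof.
move=> k_gt0 famC.
have exC (p : 'I_(#|A|.+1)) : exists C : 'I_k -> {group gT},
    socle_prime p -> kernel_family G ('O_p(A) :&: N)%G C.
  have [pP | _] := boolP (socle_prime p); last by exists (fun _ => 1%G).
  by have [C CP] := famC p pP; exists C.
have [C CP] := fin_all_exists exC.
have exs i := @irr_over_kernels (fun p => C p i)
  (fun p pP => let: And3 sCE _ _ := CP p pP in sCE i)
  (fun p pP => let: And3 _ cycC _ := CP p pP in cycC i).
have [s sP] := fin_all_exists exs.
have irr_s i : mx_irreducible (s i) by case: (sP i).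
have [n [rG [ssG kerG]]] := semisimple_constituents_dsum irr_s.
exists n, rG; split=> //; rewrite /mx_faithful rker_subg.
set L := N :&: rker rG; have nsLG : L <| G by rewrite normalI ?rker_normal.
apply/trivgP/eqP; apply: contraT => ntL.
have [M minM /subsetIP[sMN sMker]] :=
  min_normal_exists (H := [group of L]) nsLG ntL.
have [ntM nsMG _] := min_normalP minM.
have [abM | nabM] := boolP (abelian M); last first.
  have [_ _ /(_ M minM nabM)/negP[]] := sP (Ordinal k_gt0).
  exact: subset_trans sMker (kerG _).
have [p [pr_p p_dv sMO]] := min_normal_pcore minM abM.
have p_le : (p < #|A|.+1)%N by rewrite ltnS dvdn_leq ?cardG_gt0.
have pP : socle_prime (Ordinal p_le) by rewrite /socle_prime pr_p.
have [_ _ coreC] := CP (Ordinal p_le) pP.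
have sME : M \subset 'O_p(A) :&: N by rewrite subsetI sMO.
case/negP: ntM; rewrite -subG1; apply: coreC => // i.
have [_ /(_ _ pP M sME) kerC _] := sP i.
exact: kerC (subset_trans sMker (kerG i)).
Qed.

End FaithfulRepresentation.

(** * The cycle of implications *)

Theorem theorem2p24 (gT : finGroupType) (G N : {group gT}) (nsNG : N <| G)
    (F : fieldType)
    (charF : ([pchar F]%R^').-group (abelian_socle G :&: N))
    (k : nat) (k_gt0 : (0 < k)%N) :
  [<-> normal_k_generated G (socle_of G :&: N) k;
       ZG_k_generated G k (abelian_socleI_abelian G N);
       forall (p : nat) (pr_p : prime p), (p %| #|abelian_socle G|)%N ->
         FpG_k_generated G k pr_p (pcore_abelian_socleI_abelem G N pr_p);
       exists (n : nat) (rG : mx_representation F G n),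
         semisimple_constituents rG k
         /\ mx_faithful (subg_repr rG (normal_sub nsNG))].
Proof.
have nsAN : abelian_socle G :&: N <| G.
  by rewrite normalI ?abelian_socle_normal.
have nsSN : socle_of G :&: N <| G by rewrite normalI ?socle_normal.
have nsON p : 'O_p(abelian_socle G) :&: N <| G.
  by rewrite normalI // gFnormal_trans ?abelian_socle_normal.
have sOA p : 'O_p(abelian_socle G) :&: N \subset abelian_socle G :&: N.
  by rewrite setSI ?pcore_sub.
have sAS : abelian_socle G :&: N \subset socle_of G.
  by rewrite (subset_trans (subsetIl _ _)) ?abelian_socle_sub.
have sOS p : 'O_p(abelian_socle G) :&: N \subset socle_of G.
  exact: subset_trans (sOA p) sAS.
tfae.
(* The first two implications restrict generation to a smaller normal subgroup inside the socle. *)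
- move=> gen1; apply/(ZG_k_generatedP k nsAN).
  apply: normal_k_generatedS nsAN nsSN _ _ gen1; last exact: subsetIl.
  by rewrite setSI ?abelian_socle_sub.
- move/(ZG_k_generatedP k nsAN) => gen2 p pr_p _.
  apply/(FpG_k_generatedP k (nsON p)).
  exact: normal_k_generatedS (nsON p) nsAN (sOA p) sAS gen2.
- move=> gen3; apply: faithful_of_kernel_families => // p /andP[pr_p p_dv].
  have abelO := pcore_abelian_socleI_abelem G N pr_p.
  apply/(normal_k_generated_kernel_family (nsON p) k pr_p abelO (sOS p)).
  exact: (FpG_k_generatedP k (nsON p) _ _).1 (gen3 p pr_p p_dv).
(* The constituents give kernels at each prime, hence generators of each primary part; these are
   glued over the primes, and the nonabelian minimal normal subgroups are absorbed into the first
   generator. *)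
case=> n [rG [ssG faithG]].
apply: (normal_k_generated_socle nsNG k_gt0).
apply: (normal_k_generated_primes nsNG) => p pr_p _.
have abelO := pcore_abelian_socleI_abelem G N pr_p.
apply/(normal_k_generated_kernel_family (nsON p) k pr_p abelO (sOS p)).
have sON : 'O_p(abelian_socle G) :&: N \subset N := subsetIr _ _.
exact: (constituents_kernel_family (nsON p) pr_p abelO sON ssG faithG).
Qed.
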